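(* Assume that MSCQ holds for the system $G(z)\in K$ at $\bar z$. Let - $z^*\in N_{\operatorname{gph}\Gamma}(\bar z)$ with $\pi_{X^*}(z^* )=\bar x^*$, - $v=(q,u)\in{\cal K}_{\operatorname{gph}\Gamma}(\bar z,z^* )$, - $\hat\mu\in{\cal M}(\bar z,z^*;v)$, - $w^*_{x^*}\in X^*$ be such that there is a sequence $w^*_k\in{\cal K}_{\operatorname{gph}\Gamma}(\bar z,z^* )^*$ with $w^*_{x^*}=\lim_k\pi_{X^*}(w^*_k)$ and $\lim_k\langle w_k^*,v\rangle=0$. Then $$\big(q,u,\nabla(\nabla_xG(\cdot)^*\hat\mu)(\bar z)v+w^*_{x^*}\big)\in T_{\operatorname{gph}\Psi}(\bar p,\bar x,\bar x^* ),$$ and this tangent vector is derivable. In particular, for all such $z^*,v=(q,u),\hat\mu$, $$\big(q,u,\nabla(\nabla_xG(\cdot)^*\hat\mu)(\bar z)v+\pi_{X^*}(w^* )\big)\in T_{\operatorname{gph}\Psi}(\bar p,\bar x,\bar x^* )\quad\text{for all } w^*\in N_{{\cal K}_{\operatorname{gph}\Gamma}(\bar z,z^* )}(v).$$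
   Context: Notation: $X=\mathbb R^n$, $P=\mathbb R^m$, $Y=\mathbb R^l$, $Z:=P\times X$, and $E$ is finite-dimensional. Dual spaces are distinguished from primal ones, $Z^*=P^*\times X^*$, and $\pi_{X^*}(p^*,x^* ):=x^*$. $A^*$ denotes the adjoint of a linear map $A$. For $\mu\in E^*$, $\nabla(\nabla_xG(\cdot)^*\mu)(\bar z)v\in X^*$ is the derivative at $\bar z$ of the map $z\mapsto\nabla_xG(z)^*\mu$, applied to $v$. For a cone $A$, $A^*:=\{a^*:\langle a^*,a\rangle\le0\ \forall a\in A\}$ is its polar. For a closed set $\Omega$ and $\bar z\in\Omega$: the tangent cone is $T_\Omega(\bar z):=\{w:\exists\, t_k\downarrow0,\ w_k\to w \text{ with } \bar z+t_kw_k\in\Omega\}$; the regular normal cone is $N_\Omega(\bar z):=\{z^*:\limsup_{z\to\bar z,\,z\in\Omega}\langle z^*,z-\bar z\rangle/\|z-\bar z\|\le0\}$; and, for $z^*\in N_\Omega(\bar z)$, the critical cone is ${\cal K}_\Omega(\bar z,z^* ):=T_\Omega(\bar z)\cap\{z^*\}^\perp$. A tangent vector $w\in T_\Omega(\bar z)$ is derivable if there is $\xi\colon[0,\varepsilon]\to\Omega$ with $\xi(0)=\bar z$ and right derivative $\xi'_+(0)=w$. Setting: $g\colon P\times X\to Y$ is $C^2$ around $\bar z=(\bar p,\bar x)$. The set $C\subset Y$ is closed and $C^2$-cone reducible at $g(\bar z)$ to a closed convex cone $K\subset E$: there exist a neighborhood $V$ of $g(\bar z)$ and a $C^2$ map $h\colon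 V\to E$ with $h(g(\bar z))=0$, $\nabla h(g(\bar z))$ surjective, and $C\cap V=\{y\in V:h(y)\in K\}$. Set $\Gamma(p):=\{x:g(p,x)\in C\}$ with $\bar x\in\Gamma(\bar p)$, $\Psi(p,x):=N_{\Gamma(p)}(x)$, and fix $\bar x^*\in N_{\Gamma(\bar p)}(\bar x)$. Let $G:=h\circ g$, defined near $\bar z$, so that $G(\bar z)=0$. Near $\bar z$, $\operatorname{gph}\Gamma$ coincides with $\{z:G(z)\in K\}$, and for $p$ near $\bar p$, $\Gamma(p)$ coincides near $\bar x$ with $\{x:G(p,x)\in K\}$. The system $G(z)\in K$ satisfies MSCQ at $\bar z$ if there is $\kappa\ge0$ such that ${\rm dist}(z;G^{-1}(K))\le\kappa\,{\rm dist}(G(z);K)$ for all $z$ near $\bar z$. Multiplier sets: for $z^*\in N_{\operatorname{gph}\Gamma}(\bar z)$, ${\cal M}(\bar z,z^* ):=\{\mu\in K^*:\nabla G(\bar z)^*\mu=z^*\}$, and for $v\in{\cal K}_{\operatorname{gph}\Gamma}(\bar z,z^* )$, ${\cal M}(\bar z,z^*;v):=\arg\max\{\langle\mu,\nabla^2G(\bar z)(v,v)\rangle:\mu\in{\cal M}(\bar z,z^* )\}$. *)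

(* Defs.v *)
From mathcomp Require Import all_boot.
From Stdlib Require Import Reals ClassicalEpsilon.

Set Implicit Arguments.
Unset Strict Implicit.

Local Open Scope R_scope.

(* R^n, identified with its dual via the standard inner product. *)
Definition Vec (n : nat) := 'I_n -> R.

Definition vzero {n} : Vec n := fun _ => 0.
Definition vadd {n} (x y : Vec n) : Vec n := fun i => x i + y i.
Definition vsub {n} (x y : Vec n) : Vec n := fun i => x i - y i.
Definition vscale {n} (c : R) (x : Vec n) : Vec n := fun i => c * x i.
Definition dot {n} (x y : Vec n) : R := \big[Rplus/0]_(i < n) (x i * y i).
Definition norm {n} (x : Vec n) : R := sqrt (dot x x).
Definition basis {n} (i : 'I_n) : Vec n := fun j => if j == i then 1 else 0.

(* products Z = P x X realised as R^(m+n) *)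
Definition vpair {m n} (p : Vec m) (x : Vec n) : Vec (m + n) :=
  fun i => match fintype.split i with inl j => p j | inr j => x j end.
Definition vfst {m n} (z : Vec (m + n)) : Vec m := fun i => z (lshift n i).
Definition vsnd {m n} (z : Vec (m + n)) : Vec n := fun j => z (rshift m j).

Definition ball {n} (c : Vec n) (r : R) : Vec n -> Prop :=
  fun y => norm (vsub y c) < r.
Definition is_open {n} (U : Vec n -> Prop) : Prop :=
  forall y, U y -> exists r, 0 < r /\ forall y', ball y r y' -> U y'.
Definition vconv {n} (s : nat -> Vec n) (l : Vec n) : Prop :=
  forall eps, 0 < eps -> exists N : nat, forall k : nat, (N <= k)%nat ->
    norm (vsub (s k) l) < eps.
Definition is_closed {n} (S : Vec n -> Prop) : Prop :=
  forall (s : nat -> Vec n) l, (forall k, S (s k)) -> vconv s l -> S l.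
Definition is_convex {n} (S : Vec n -> Prop) : Prop :=
  forall x y t, S x -> S y -> 0 <= t <= 1 ->
    S (vadd (vscale t x) (vscale (1 - t) y)).
Definition is_cone {n} (S : Vec n -> Prop) : Prop :=
  S vzero /\ forall t x, 0 <= t -> S x -> S (vscale t x).
Definition continuous_on {a b} (U : Vec a -> Prop) (f : Vec a -> Vec b) : Prop :=
  forall y, U y -> forall eps, 0 < eps -> exists del, 0 < del /\
    forall y', U y' -> norm (vsub y' y) < del -> norm (vsub (f y') (f y)) < eps.

(* dist(z;S) <= r (distance = infimum of distances) *)
Definition dist_le {n} (S : Vec n -> Prop) (z : Vec n) (r : R) : Prop :=
  forall eps, 0 < eps -> exists s, S s /\ norm (vsub z s) < r + eps.

Definition is_linear {a b} (L : Vec a -> Vec b) : Prop :=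
  (forall x y, L (vadd x y) = vadd (L x) (L y)) /\
  (forall c x, L (vscale c x) = vscale c (L x)).
Definition is_fderiv {a b} (f : Vec a -> Vec b) (x : Vec a) (L : Vec a -> Vec b) : Prop :=
  is_linear L /\
  forall eps, 0 < eps -> exists del, 0 < del /\ forall y, norm (vsub y x) < del ->
    norm (vsub (vsub (f y) (f x)) (L (vsub y x))) <= eps * norm (vsub y x).
(* the (Frechet) derivative nabla f(x); meaningful when f is differentiable at x *)
Definition fderiv {a b} (f : Vec a -> Vec b) (x : Vec a) : Vec a -> Vec b :=
  match excluded_middle_informative (exists L, is_fderiv f x L) with
  | left H => proj1_sig (constructive_indefinite_description _ H)
  | right _ => fun _ => vzero
  end.
Definition hess {a b} (f : Vec a -> Vec b) (x v w : Vec a) : Vec b :=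
  fderiv (fun y => fderiv f y v) x w.
Definition pderiv_x {m n b} (f : Vec (m + n) -> Vec b) (z : Vec (m + n)) : Vec n -> Vec b :=
  fderiv (fun x => f (vpair (vfst z) x)) (vsnd z).
Definition adj {a b} (A : Vec a -> Vec b) (mu : Vec b) : Vec a :=
  fun i => dot mu (A (basis i)).
Definition C2_on {a b} (U : Vec a -> Prop) (f : Vec a -> Vec b) : Prop :=
  exists (Df : Vec a -> Vec a -> Vec b) (D2f : Vec a -> Vec a -> Vec a -> Vec b),
    (forall y, U y -> is_fderiv f y (Df y)) /\
    (forall y v, U y -> is_fderiv (fun z => Df z v) y (fun w => D2f y w v)) /\
    (forall v w, continuous_on U (fun y => D2f y w v)).
Definition surjective_map {a b} (L : Vec a -> Vec b) : Prop :=
  forall e, exists y, L y = e.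

Definition tangent_cone {n} (Om : Vec n -> Prop) (z w : Vec n) : Prop :=
  exists (t : nat -> R) (ws : nat -> Vec n),
    (forall k, 0 < t k) /\ Un_cv t 0 /\ vconv ws w /\
    (forall k, Om (vadd z (vscale (t k) (ws k)))).
Definition normal_cone {n} (Om : Vec n -> Prop) (z zs : Vec n) : Prop :=
  Om z /\
  forall eps, 0 < eps -> exists del, 0 < del /\ forall y, Om y ->
    norm (vsub y z) < del -> dot zs (vsub y z) <= eps * norm (vsub y z).
Definition polar {n} (A : Vec n -> Prop) (a : Vec n) : Prop :=
  forall x, A x -> dot a x <= 0.
Definition critical_cone {n} (Om : Vec n -> Prop) (z zs : Vec n) (w : Vec n) : Prop :=
  tangent_cone Om z w /\ dot zs w = 0.
Definition derivable_tangent {n} (Om : Vec n -> Prop) (z w : Vec n) : Prop :=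
  exists eps, 0 < eps /\ exists xi : R -> Vec n,
    xi 0 = z /\ (forall t, 0 <= t <= eps -> Om (xi t)) /\
    forall eta, 0 < eta -> exists del, 0 < del /\ forall t, 0 < t < del -> t <= eps ->
      norm (vsub (vscale (/ t) (vsub (xi t) z)) w) < eta.

Definition Gamma {m n l} (g : Vec (m + n) -> Vec l) (C : Vec l -> Prop) (p : Vec m) : Vec n -> Prop :=
  fun x => C (g (vpair p x)).
Definition gphGamma {m n l} (g : Vec (m + n) -> Vec l) (C : Vec l -> Prop) : Vec (m + n) -> Prop :=
  fun z => C (g z).
Definition gphPsi {m n l} (g : Vec (m + n) -> Vec l) (C : Vec l -> Prop) : Vec ((m + n) + n) -> Prop :=
  fun w => normal_cone (Gamma g C (vfst (vfst w))) (vsnd (vfst w)) (vsnd w).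

Definition MSCQ {a d} (G : Vec a -> Vec d) (K : Vec d -> Prop) (zb : Vec a) : Prop :=
  exists kappa r, 0 <= kappa /\ 0 < r /\ forall z, ball zb r z ->
    forall k, K k -> dist_le (fun y => K (G y)) z (kappa * norm (vsub (G z) k)).

Definition mult_set {a d} (G : Vec a -> Vec d) (K : Vec d -> Prop) (zb zs : Vec a) (mu : Vec d) : Prop :=
  polar K mu /\ adj (fderiv G zb) mu = zs.
Definition mult_set_v {a d} (G : Vec a -> Vec d) (K : Vec d -> Prop) (zb zs v : Vec a) (mu : Vec d) : Prop :=
  mult_set G K zb zs mu /\
  forall mu', mult_set G K zb zs mu' -> dot mu' (hess G zb v v) <= dot mu (hess G zb v v).

(* Main.v *)
Require Import Defs.
From HB Require Import structures.
From mathcomp Require Import all_boot.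
From Stdlib Require Import Reals Lra FunctionalExtensionality ClassicalEpsilon Classical.

(* Write zb for the reference point, S = gph Gamma, A for the derivative of G at zb, and
   L(z) = <mu, G(z)>, mu being the given multiplier.  For small t > 0 minimise

     - L(z) - t <w, z - zb> + |z - zb - t v|^2 / 2

   over the points z of S near zb.  By Fermat's rule a minimiser z_t carries the normal
   DG(z_t)^* mu + t w - (z_t - zb - t v) to S, whose X*-component is a normal to the section
   Gamma(p) and has the wanted first-order expansion as soon as z_t = zb + t v + o(t).  This
   expansion comes from comparing z_t with points y_t = zb + t v + O(t^2) of S such that
   - L(y_t) <= o(t^2).  These exist by metric subregularity and second-order Taylor expansion,
   because the maximality of mu yields, by conic duality, s with A s + D^2 G(zb)(v, v) almost in
   K and <z*, s> almost equal to - <mu, D^2 G(zb)(v, v)>; no attainment is needed.  Cluster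
   points of (z_t - zb) / t then lie in the critical cone, on which w is nonpositive. *)

Local Open Scope R_scope.

(** The obvious construction would perturb the multiplier along with the point, writing [w] as
    [adj A nu] with [nu] in K^* + R mu. This can fail: the polar of the critical cone is only the
    closure of the image of that sum. The penalised problem uses [w] solely through its sign on the
    critical cone. Its terms are balanced at the scale t^2: with z = zb + t u, the linear and
    quadratic terms are exactly t^2 times functions of u. In the limit <w, u> <= 0, hence |u - v|^2
    <= - 2 <w, v>. For a fixed [w] this is a defect that need not vanish; it disappears along w_k
    because <w_k, v> tends to 0. All approximation statements therefore carry a tolerance whose
    square dominates - 2 <w, v>, and one arc is assembled only at the very end. *)

HB.instance Definition _ := Monoid.isComLaw.Build R 0 Rplus
  (fun x y z => esym (Rplus_assoc x y z)) Rplus_comm Rplus_0_l.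

Ltac vring :=
  apply: functional_extensionality => ?; rewrite /vadd /vsub /vscale /vzero; ring.

(** * Euclidean geometry *)

Lemma sum_scale {n} (c : R) (F : 'I_n -> R) :
  \big[Rplus/0]_(i < n) (c * F i) = c * \big[Rplus/0]_(i < n) F i.
Proof.
by apply: (big_ind2 (fun a b => a = c * b)) => [|a a' b b' -> ->|//]; ring.
Qed.

Lemma sum_ge0 {n} (F : 'I_n -> R) :
  (forall i, 0 <= F i) -> 0 <= \big[Rplus/0]_(i < n) F i.
Proof.
by move=> F0; apply: (big_ind (Rle 0)) => //; first lra; move=> x y; lra.
Qed.

Lemma term_le_sum {n} (F : 'I_n -> R) (i : 'I_n) :
  (forall j, 0 <= F j) -> F i <= \big[Rplus/0]_(j < n) F j.
Proof.
move=> F0; rewrite (bigD1 i) //= -{1}[F i]Rplus_0_r; apply: Rplus_le_compat_l.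
by apply: (big_ind (Rle 0)) => //; first lra; move=> x y; lra.
Qed.

Lemma dotC {n} (x y : Vec n) : dot x y = dot y x.
Proof. by apply: eq_bigr => i _; ring. Qed.

Lemma dotDr {n} (x y z : Vec n) : dot x (vadd y z) = dot x y + dot x z.
Proof. by rewrite /dot -big_split /=; apply: eq_bigr => i _; rewrite /vadd; ring. Qed.

Lemma dotZr {n} (c : R) (x y : Vec n) : dot x (vscale c y) = c * dot x y.
Proof. by rewrite /dot -sum_scale; apply: eq_bigr => i _; rewrite /vscale; ring. Qed.

Lemma dotBr {n} (x y z : Vec n) : dot x (vsub y z) = dot x y - dot x z.
Proof.
have -> : vsub y z = vadd y (vscale (-1) z) by vring.
by rewrite dotDr dotZr; ring.
Qed.

Lemma dotDl {n} (x y z : Vec n) : dot (vadd y z) x = dot y x + dot z x.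
Proof. by rewrite dotC dotDr !(dotC x). Qed.

Lemma dotZl {n} (c : R) (x y : Vec n) : dot (vscale c y) x = c * dot y x.
Proof. by rewrite dotC dotZr !(dotC x). Qed.

Lemma dotBl {n} (x y z : Vec n) : dot (vsub y z) x = dot y x - dot z x.
Proof. by rewrite dotC dotBr !(dotC x). Qed.

Lemma dot0r {n} (x : Vec n) : dot x vzero = 0.
Proof. by rewrite /dot big1 // => i _; rewrite /vzero; ring. Qed.

Lemma dot0l {n} (x : Vec n) : dot vzero x = 0.
Proof. by rewrite dotC dot0r. Qed.

Lemma dot_basis {n} (x : Vec n) i : dot (basis i) x = x i.
Proof.
rewrite /dot (bigD1 i) //= big1 /basis; first by rewrite eqxx; ring.
by move=> j /negbTE ->; ring.
Qed.

Definition dotE := (@dotDl, @dotDr, @dotBl, @dotBr, @dotZl, @dotZr).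

Lemma dot_ge0 {n} (x : Vec n) : 0 <= dot x x.
Proof. by apply: sum_ge0 => i; nra. Qed.

Lemma norm_ge0 {n} (x : Vec n) : 0 <= norm x.
Proof. exact: sqrt_pos. Qed.

Lemma norm_sq {n} (x : Vec n) : norm x * norm x = dot x x.
Proof. exact: sqrt_sqrt (dot_ge0 x). Qed.

Lemma norm_le {n} (x : Vec n) (c : R) : 0 <= c -> dot x x <= c * c -> norm x <= c.
Proof.
move=> c0; rewrite -norm_sq => le; apply: Rnot_lt_le => lt.
by have := Rmult_le_0_lt_compat _ _ _ _ c0 c0 lt lt; lra.
Qed.

Lemma dot_le {n} (x y : Vec n) : dot x y <= norm x * norm y.
Proof.
have [nx ny] := (norm_ge0 x, norm_ge0 y).
have [yy|yy] := Req_dec (dot y y) 0.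
  have -> : y = vzero.
    apply: functional_extensionality => i.
    have : y i * y i <= dot y y by apply: (@term_le_sum n (fun i => y i * y i)) => j; nra.
    by rewrite /vzero yy; nra.
  by rewrite dot0r; have := norm_ge0 (@vzero n); nra.
(* This squared norm equals <y,y> (<x,x><y,y> - <x,y>^2). *)
have := dot_ge0 (vsub (vscale (dot y y) x) (vscale (dot x y) y)).
rewrite !dotE (dotC y x).
have : 0 < dot y y by have := dot_ge0 y; lra.
move: (norm_sq x) (norm_sq y).
move: (dot x x) (dot y y) (dot x y) (norm x) (norm y) nx ny {yy} => xx yy xy a b a0 b0 <- <- y0 H.
have {}H : xy * xy <= (a * b) * (a * b).
  by apply: (Rmult_le_reg_l (b * b)); lra.
have ab : 0 <= a * b by nra.
by apply: Rnot_lt_le => lt; have := Rmult_le_0_lt_compat _ _ _ _ ab ab lt lt; lra.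
Qed.

Lemma norm_add {n} (x y : Vec n) : norm (vadd x y) <= norm x + norm y.
Proof.
have := norm_ge0 x; have := norm_ge0 y; have := dot_le x y.
move=> H1 H2 H3; apply: norm_le; first lra.
rewrite !dotE -!norm_sq (dotC y x); nra.
Qed.

Lemma norm_scale {n} (c : R) (x : Vec n) : norm (vscale c x) = Rabs c * norm x.
Proof.
rewrite /norm !dotE -Rmult_assoc sqrt_mult; [|nra|exact: dot_ge0].
by rewrite -[c * c]/(Rsqr c) sqrt_Rsqr_abs.
Qed.

Lemma norm_opp {n} (x y : Vec n) : norm (vsub x y) = norm (vsub y x).
Proof.
have -> : vsub x y = vscale (-1) (vsub y x) by vring.
by rewrite norm_scale Rabs_left; lra.
Qed.

Lemma norm_sub {n} (x y : Vec n) : norm (vsub x y) <= norm x + norm y.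
Proof.
have -> : vsub x y = vadd x (vscale (-1) y) by vring.
have := norm_add x (vscale (-1) y); rewrite norm_scale Rabs_left; lra.
Qed.

Lemma norm_tri {n} (y x z : Vec n) : norm (vsub x z) <= norm (vsub x y) + norm (vsub y z).
Proof.
have -> : vsub x z = vadd (vsub x y) (vsub y z) by vring.
exact: norm_add.
Qed.

Lemma norm0 {n} : norm (@vzero n) = 0.
Proof. by rewrite /norm dot0r sqrt_0. Qed.

Lemma norm_self {n} (x : Vec n) : norm (vsub x x) = 0.
Proof. by rewrite -(@norm0 n); congr norm; vring. Qed.

Lemma dot_abs_le {n} (x y : Vec n) : Rabs (dot x y) <= norm x * norm y.
Proof.
apply: Rabs_le; split; last exact: dot_le.
have := dot_le (vscale (-1) x) y; rewrite dotZl norm_scale Rabs_left; lra.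
Qed.

Lemma coord_le_norm {n} (x : Vec n) i : Rabs (x i) <= norm x.
Proof.
rewrite /norm -sqrt_Rsqr_abs; apply: sqrt_le_1_alt.
by apply: (@term_le_sum n (fun i => x i * x i)) => j; nra.
Qed.

Lemma norm_eq0 {n} (x : Vec n) : norm x = 0 -> x = vzero.
Proof.
move=> x0; apply: functional_extensionality => i.
have := coord_le_norm x i; rewrite x0 /vzero; have := Rabs_pos (x i).
move=> h1 h2; apply: NNPP => /Rabs_pos_lt; lra.
Qed.

Lemma norm_le_coord {n} (x : Vec n) (c : R) : 0 <= c ->
  (forall i, Rabs (x i) <= c) -> norm x <= INR n * c.
Proof.
move=> c0 H.
have N1 : INR n <= INR n * INR n.
  case: (n) => [|p]; first by rewrite /=; lra.
  by have := S_INR p; have := pos_INR p; nra.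
have n0 := pos_INR n.
apply: norm_le; first by nra.
apply: (Rle_trans _ (INR n * (c * c))); last by nra.
rewrite /dot; elim: n x H {N1 n0} => [|p IH] x H.
  by rewrite big_ord0 /=; lra.
rewrite big_ord_recl S_INR.
have := IH (fun i => x (lift ord0 i)) (fun i => H _).
have := H ord0; have := Rabs_pos (x ord0).
have -> : x ord0 * x ord0 = Rabs (x ord0) * Rabs (x ord0).
  by rewrite -Rabs_mult Rabs_pos_eq //; nra.
move: (\big[_/_]_(_ < _) _) => s; nra.
Qed.

Lemma dot_vpair {m n} (p p' : Vec m) (x x' : Vec n) :
  dot (vpair p x) (vpair p' x') = dot p p' + dot x x'.
Proof.
rewrite /dot big_split_ord /=; congr (_ + _); apply: eq_bigr => i _.
- by rewrite /vpair (unsplitK (inl i)).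
- by rewrite /vpair (unsplitK (inr i)).
Qed.

Lemma vfst_pair {m n} (p : Vec m) (x : Vec n) : vfst (vpair p x) = p.
Proof.
by apply: functional_extensionality => i; rewrite /vfst /vpair (unsplitK (inl i)).
Qed.

Lemma vsnd_pair {m n} (p : Vec m) (x : Vec n) : vsnd (vpair p x) = x.
Proof.
by apply: functional_extensionality => i; rewrite /vsnd /vpair (unsplitK (inr i)).
Qed.

Lemma vpair_eta {m n} (z : Vec (m + n)) : vpair (vfst z) (vsnd z) = z.
Proof.
apply: functional_extensionality => i; rewrite /vpair -{2}(splitK i).
by case: (fintype.split i).
Qed.

Lemma vpair_sub {m n} (p p' : Vec m) (x x' : Vec n) :
  vsub (vpair p x) (vpair p' x') = vpair (vsub p p') (vsub x x').
Proof.
by apply: functional_extensionality => i; rewrite /vsub /vpair; case: fintype.split.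
Qed.

Lemma vpair_add {m n} (p p' : Vec m) (x x' : Vec n) :
  vadd (vpair p x) (vpair p' x') = vpair (vadd p p') (vadd x x').
Proof.
by apply: functional_extensionality => i; rewrite /vadd /vpair; case: fintype.split.
Qed.

Lemma vpair_scale {m n} c (p : Vec m) (x : Vec n) :
  vscale c (vpair p x) = vpair (vscale c p) (vscale c x).
Proof.
by apply: functional_extensionality => i; rewrite /vscale /vpair; case: fintype.split.
Qed.

Lemma norm_vpair_le {m n} (p : Vec m) (x : Vec n) : norm (vpair p x) <= norm p + norm x.
Proof.
have := norm_ge0 p; have := norm_ge0 x => ? ?.
apply: norm_le; first lra.
by rewrite dot_vpair -!norm_sq; nra.
Qed.

Lemma norm_vpair0 {m n} (x : Vec n) : norm (vpair (@vzero m) x) = norm x.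
Proof. by rewrite /norm dot_vpair dot0r Rplus_0_l. Qed.

Lemma norm_vfst_le {m n} (z : Vec (m + n)) : norm (vfst z) <= norm z.
Proof.
rewrite -{2}(vpair_eta z) /norm dot_vpair; apply: sqrt_le_1_alt.
by have := dot_ge0 (vsnd z); lra.
Qed.

Lemma norm_vsnd_le {m n} (z : Vec (m + n)) : norm (vsnd z) <= norm z.
Proof.
rewrite -{2}(vpair_eta z) /norm dot_vpair; apply: sqrt_le_1_alt.
by have := dot_ge0 (vfst z); lra.
Qed.

(** * Compactness, minimisation and separation *)

Lemma inv_succ_pos k : 0 < / (INR k + 1).
Proof. by apply: Rinv_0_lt_compat; have := pos_INR k; lra. Qed.

Lemma inv_succ_small (eps : R) : 0 < eps ->
  exists N : nat, forall k : nat, (N <= k)%nat -> / (INR k + 1) < eps.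
Proof.
move=> /archimed_cor1 [N [lt /ltP N0]]; exists N => k /leP /le_INR Nk.
have N1 : 0 < INR N by apply: lt_0_INR; apply/ltP.
by apply: Rle_lt_trans lt; apply: Rinv_le_contravar; lra.
Qed.

Lemma finite_pos {n} (P : 'I_n -> R -> Prop) :
  (forall i d d', d' <= d -> P i d -> P i d') ->
  (forall i, exists d, 0 < d /\ P i d) -> exists d, 0 < d /\ forall i, P i d.
Proof.
move=> mono ex.
have [d [d0 H]] : exists d, 0 < d /\ forall i, i \in enum 'I_n -> P i d.
  elim: (enum 'I_n) => [|j s [d [d0 IH]]]; first by exists 1; split => //; lra.
  have [e [e0 He]] := ex j; exists (Rmin d e); split; first exact: Rmin_pos.
  move=> i; rewrite inE => /orP [/eqP ->|/IH].
    exact: mono (Rmin_r _ _) He.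
  exact: mono (Rmin_l _ _).
by exists d; split => // i; apply: H; rewrite mem_enum.
Qed.

Lemma vconv_coord {n} (s : nat -> Vec n) (l : Vec n) :
  (forall i, Un_cv (fun k => s k i) (l i)) -> vconv s l.
Proof.
move=> H eps eps0; set e := eps / (INR n + 1).
have n0 := pos_INR n.
have e0 : 0 < e by apply: Rdiv_lt_0_compat; lra.
have /(_ _)/constructive_indefinite_description N_ := fun i => H i e e0.
exists (\max_i (sval (N_ i)))%nat => k le.
apply: (Rle_lt_trans _ (INR n * e)).
  apply: norm_le_coord => [|i]; first lra.
  apply: Rlt_le; apply: (svalP (N_ i)); apply/leP; apply: leq_trans le.
  exact: (leq_bigmax i).
have -> : eps = INR n * e + e by rewrite /e; field; lra.
lra.
Qed.

Lemma bounded_subseq_R (u : nat -> R) (B : R) : (forall k, Rabs (u k) <= B) ->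
  exists (phi : nat -> nat) l, (forall k, (k <= phi k)%nat) /\ Un_cv (fun k => u (phi k)) l.
Proof.
move=> uB; have bd k : - B <= u k <= B.
  have := uB k; have := Rle_abs (u k); have := Rle_abs (- u k).
  by rewrite Rabs_Ropp; lra.
have [l adh] := Bolzano_Weierstrass u _ (compact_P3 (- B) B) bd.
have sub k : exists p, (k <= p)%nat /\ Rabs (u p - l) < / (INR k + 1).
  have [|p [/leP kp lt]] := adh (fun y => Rabs (y - l) < / (INR k + 1)) k.
    by exists (mkposreal _ (inv_succ_pos k)).
  by exists p.
have /(_ _)/constructive_indefinite_description f := sub.
exists (fun k => sval (f k)), l; split=> [k|eps /inv_succ_small [N HN]].
  by case: (svalP (f k)).
exists N => k /leP /HN; have [_] := svalP (f k); rewrite /R_dist; lra.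
Qed.

(** The sequence is thinned one coordinate at a time, by induction over the list of coordinates
    already made convergent. The bound [k <= phi k] stands in for strict monotonicity: it survives
    composition and is all that passing to a limit requires. *)
Lemma bounded_subseq {n} (s : nat -> Vec n) (B : R) : (forall k, norm (s k) <= B) ->
  exists (phi : nat -> nat) l, (forall k, (k <= phi k)%nat) /\ vconv (fun k => s (phi k)) l.
Proof.
move=> sB.
have [phi [l [ge cv]]] : exists (phi : nat -> nat) (l : Vec n), (forall k, (k <= phi k)%nat) /\
    forall i, i \in enum 'I_n -> Un_cv (fun k => s (phi k) i) (l i).
  elim: (enum 'I_n) => [|j r [phi [l [ge cv]]]]; first by exists (fun k => k), vzero.
  have [k|psi [x [ge' cv']]] := @bounded_subseq_R (fun k => s (phi k) j) B.
    exact: Rle_trans (coord_le_norm _ _) (sB _).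
  exists (fun k => phi (psi k)), (fun i => if i == j then x else l i); split.
    by move=> k; apply: leq_trans (ge' k) (ge _).
  move=> i; rewrite inE; case: eqVneq => [-> _|_ /= /cv cvi eps eps0]; first exact: cv'.
  have [N HN] := cvi eps eps0; exists N => k /leP Nk; apply: HN.
  by apply/leP; apply: leq_trans Nk (ge' k).
by exists phi, l; split=> //; apply: vconv_coord => i; apply: cv; rewrite mem_enum.
Qed.

Lemma vconv_norm_le {n} (s : nat -> Vec n) l x (B : R) : vconv s l ->
  (forall k, norm (vsub (s k) x) <= B) -> norm (vsub l x) <= B.
Proof.
move=> cv le; apply: le_epsilon => eps /cv [N /(_ N (leqnn N))].
by have := norm_tri (s N) l x; have := le N; rewrite (norm_opp l (s N)); lra.
Qed.

Lemma exists_inf {T} (S : T -> Prop) (f : T -> R) (b : R) (x0 : T) : S x0 ->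
  (forall x, S x -> b <= f x) ->
  exists m, (forall x, S x -> m <= f x) /\ forall e, 0 < e -> exists x, S x /\ f x < m + e.
Proof.
move=> S0 lb.
have [||m [ub lub]] := completeness (fun r => exists x, S x /\ r = - f x).
- by exists (- b) => _ [x [/lb le ->]]; lra.
- by exists (- f x0), x0.
exists (- m); split=> [x Sx|e e0].
  by have := ub (- f x) (ex_intro _ x (conj Sx erefl)); lra.
apply: NNPP => no; have : m <= m - e; last by lra.
apply: lub => _ [x [Sx ->]]; apply: Rnot_lt_le => lt; apply: no.
by exists x; split=> //; lra.
Qed.

(** The direct method: a minimising sequence has a cluster point in [S], and the last hypothesis,
    lower semicontinuity relative to [S], bounds the value there by the infimum. *)
Lemma exists_minimizer {n} (S : Vec n -> Prop) (f : Vec n -> R) (b B : R) (x0 : Vec n) :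
  S x0 -> (forall x, S x -> b <= f x) -> (forall x, S x -> norm x <= B) ->
  (forall s l, (forall k, S (s k)) -> vconv s l -> S l) ->
  (forall x, S x -> forall e, 0 < e -> exists del, 0 < del /\
     forall y, S y -> norm (vsub y x) < del -> f x < f y + e) ->
  exists x, S x /\ forall y, S y -> f x <= f y.
Proof.
move=> S0 lb bd cl lsc; have [m [mlb inf]] := exists_inf S f b x0 S0 lb.
have /(_ _)/constructive_indefinite_description s_ := fun k => inf _ (inv_succ_pos k).
have [k|phi [x [ge cv]]] := @bounded_subseq n (fun k => sval (s_ k)) B.
  by case: (svalP (s_ k)) => /bd.
have Sx : S x by apply: (cl _ _ _ cv) => k; case: (svalP (s_ (phi k))).
exists x; split=> // y /mlb le; apply: Rle_trans le; apply: le_epsilon => e e0.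
have e2 : 0 < e / 2 by lra.
have [del [del0 Hdel]] := lsc x Sx (e / 2) e2.
have [N HN] := cv _ del0; have [M HM] := inv_succ_small _ e2.
have [Ss lt] := svalP (s_ (phi (maxn N M))).
have := Hdel _ Ss (HN _ (leq_maxl N M)).
by have := HM _ (leq_trans (leq_maxr N M) (ge _)); lra.
Qed.

(** A convex cone, with convexity expressed as stability under sums, the form in which it is both
    used and checked on image cones. *)
Definition additive_cone {n} (Q : Vec n -> Prop) : Prop :=
  is_cone Q /\ forall x y, Q x -> Q y -> Q (vadd x y).

Lemma cone_additive {n} (K : Vec n -> Prop) : is_cone K -> is_convex K -> additive_cone K.
Proof.
move=> [K0 KZ] cv; split=> // x y Kx Ky.
have -> : vadd x y = vscale 2 (vadd (vscale (/ 2) x) (vscale (1 - / 2) y)).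
  by apply: functional_extensionality => i; rewrite /vadd /vscale; field.
by apply: KZ; [lra|apply: cv => //; lra].
Qed.

(** Turns minimality of a squared distance along a segment into a first-order inequality. If
    [a < 0], a negative value occurs at the vertex - a / (2 b), or at 1 when there is no vertex in
    the interval. *)
Lemma quad_ge0_slope (a b : R) :
  (forall t, 0 < t <= 1 -> 0 <= a * t + b * (t * t)) -> 0 <= a.
Proof.
move=> H; apply: Rnot_lt_le => a0.
have [b0|b0] := Rle_dec b 0; first by have := H 1; lra.
have [c|c] := Rle_dec (- a / (2 * b)) 1.
  have e : b * (- a / (2 * b)) = - a / 2 by field; lra.
  have p : 0 < - a / (2 * b) by apply: Rdiv_lt_0_compat; lra.
  by have := H (- a / (2 * b)) (conj p c); rewrite -Rmult_assoc e; nra.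
have : 1 * (2 * b) < - a / (2 * b) * (2 * b) by apply: Rmult_lt_compat_r; lra.
have -> : - a / (2 * b) * (2 * b) = - a by field; lra.
by have := H 1; lra.
Qed.

(* The normal is [p - l], where [l] is a limit of points of [Q] whose distance to [p] tends
   to the infimum, so that [Q] need not be closed. *)
Lemma cone_separation {n} (Q : Vec n -> Prop) (p : Vec n) (eps : R) :
  additive_cone Q -> 0 < eps -> (forall q, Q q -> eps <= norm (vsub p q)) ->
  exists nu, 0 < dot nu p /\ forall q, Q q -> dot nu q <= 0.
Proof.
move=> [[Q0 QZ] QD] eps0 far.
have [m [mlb inf]] := exists_inf Q (fun q => norm (vsub p q)) eps vzero Q0 far.
have /(_ _)/constructive_indefinite_description s_ := fun k => inf _ (inv_succ_pos k).
have [k|phi [l [ge cv]]] := @bounded_subseq n (fun k => sval (s_ k)) (norm p + (m + 1)).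
  have [_] := svalP (s_ k); set q := sval _ => lt.
  have -> : q = vsub p (vsub p q) by vring.
  have := norm_sub p (vsub p q); have : / (INR k + 1) <= 1; last by lra.
  by rewrite -Rinv_1; apply: Rinv_le_contravar; have := pos_INR k; lra.
have m0 : 0 < m.
  apply: Rnot_le_lt => m0; have [|q [Qq lt]] := inf eps; first lra.
  by have := far q Qq; lra.
have pl : norm (vsub p l) <= m.
  apply: le_epsilon => e e0; have e2 : 0 < e / 2 by lra.
  have [N HN] := cv _ e2; have [M HM] := inv_succ_small _ e2.
  have [_ lt] := svalP (s_ (phi (maxn N M))).
  have := HN _ (leq_maxl N M); have := HM _ (leq_trans (leq_maxr N M) (ge _)).
  by have := norm_tri (sval (s_ (phi (maxn N M)))) p l; lra.
(* The limit [l] may lie outside [Q], but [c l + q] is a limit of points of [Q], so its distance to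
   [p] is still at least [m]. *)
have key c q : 0 <= c -> Q q -> m <= norm (vsub (vsub p (vscale c l)) q).
  move=> c0 Qq; apply: le_epsilon => e e0.
  have e2 : 0 < e / (c + 1) by apply: Rdiv_lt_0_compat; lra.
  have [N /(_ N (leqnn N))] := cv _ e2; set x := sval _ => lt.
  have Qx : Q x by case: (svalP (s_ (phi N))).
  apply: (Rle_trans _ _ _ (mlb _ (QD _ _ (QZ c x c0 Qx) Qq))).
  have -> : vsub p (vadd (vscale c x) q) =
    vadd (vsub (vsub p (vscale c l)) q) (vscale (- c) (vsub x l)) by vring.
  have := norm_add (vsub (vsub p (vscale c l)) q) (vscale (- c) (vsub x l)).
  rewrite norm_scale Rabs_Ropp Rabs_pos_eq //.
  have : c * norm (vsub x l) <= e; last by lra.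
  have -> : e = (c + 1) * (e / (c + 1)) by field; lra.
  by have := norm_ge0 (vsub x l); nra.
have key2 c q : 0 <= c -> Q q -> m * m <=
    dot (vsub (vsub p (vscale c l)) q) (vsub (vsub p (vscale c l)) q).
  by move=> c0 Qq; rewrite -norm_sq; have := key c q c0 Qq; nra.
have plm : dot (vsub p l) (vsub p l) <= m * m.
  by rewrite -norm_sq; have := norm_ge0 (vsub p l); nra.
have plm' : m * m <= dot (vsub p l) (vsub p l).
  have -> : vsub p l = vsub (vsub p (vscale 1 l)) vzero by vring.
  by apply: key2 => //; lra.
exists (vsub p l); split.
  (* Moving from [l] towards the apex cannot reduce the distance to [p], so <p - l, l> >= 0 and
     therefore <p - l, p> >= m^2 > 0. *)
  have : 0 <= 2 * dot (vsub p l) l.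
    apply: (@quad_ge0_slope _ (dot l l)) => t [t0 t1].
    have t2 : 0 <= 1 - t by lra.
    have := key2 (1 - t) vzero t2 Q0.
    by move: plm; rewrite !dotE !dot0r !dot0l (dotC l p); lra.
  have : 0 < m * m by nra.
  by move: plm'; rewrite !dotE (dotC l p); lra.
move=> q Qq; suff : 0 <= - (2 * dot (vsub p l) q) by lra.
apply: (@quad_ge0_slope _ (dot q q)) => t [t0 t1].
have t2 : 0 <= t by lra.
have := key2 1 _ Rle_0_1 (QZ t q t2 Qq).
by move: plm; rewrite !dotE (dotC l p) (dotC q p) (dotC q l); lra.
Qed.

(** * Differential calculus *)

Lemma basis_sum {n} (x : Vec n) : x = \big[vadd/vzero]_(j < n) vscale (x j) (basis j).
Proof.
apply: functional_extensionality => i.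
rewrite (big_morph (fun v : Vec n => v i) (id1 := 0) (op1 := Rplus)) //.
rewrite -{1}(dot_basis x i); apply: eq_bigr => j _.
by rewrite /basis /vscale eq_sym; ring.
Qed.

Lemma linear0 {a b} (L : Vec a -> Vec b) : is_linear L -> L vzero = vzero.
Proof.
move=> [_ LZ]; have -> : @vzero a = vscale 0 vzero by vring.
by rewrite LZ; vring.
Qed.

Lemma linearB {a b} (L : Vec a -> Vec b) x y : is_linear L ->
  L (vsub x y) = vsub (L x) (L y).
Proof.
move=> [LD LZ]; have -> : vsub x y = vadd x (vscale (-1) y) by vring.
by rewrite LD LZ; vring.
Qed.

Lemma dot_adj {a b} (L : Vec a -> Vec b) (mu : Vec b) x : is_linear L ->
  dot mu (L x) = dot (adj L mu) x.
Proof.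
move=> Llin; have [LD LZ] := Llin; rewrite {1}(basis_sum x).
rewrite (big_morph L LD (linear0 L Llin)).
rewrite (big_morph (dot mu) (dotDr mu) (dot0r mu)).
by apply: eq_bigr => j _; rewrite LZ dotZr /adj; ring.
Qed.

Lemma linear_bound {a b} (L : Vec a -> Vec b) : is_linear L ->
  exists M, 0 <= M /\ forall x, norm (L x) <= M * norm x.
Proof.
move=> Llin.
pose c := \big[Rplus/0]_(i < b) norm (adj L (basis i)).
have c0 : 0 <= c by apply: sum_ge0 => i; exact: norm_ge0.
exists (INR b * c); split; first by have := pos_INR b; nra.
move=> x; rewrite Rmult_assoc; have x0 := norm_ge0 x.
apply: norm_le_coord => [|i]; first by nra.
rewrite -dot_basis dot_adj //; apply: (Rle_trans _ _ _ (dot_abs_le _ _)).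
apply: Rmult_le_compat_r => //.
by apply: (@term_le_sum b (fun i => norm (adj L (basis i)))) => j; exact: norm_ge0.
Qed.

Lemma linear_ext {a b} (L L' : Vec a -> Vec b) : is_linear L -> is_linear L' ->
  (forall i, adj L (basis i) = adj L' (basis i)) -> L = L'.
Proof.
move=> l l' e; apply: functional_extensionality => x.
apply: functional_extensionality => i.
by rewrite -(dot_basis (L x)) -(dot_basis (L' x)) !dot_adj // e.
Qed.

(** Differentiability of a scalar function, with the derivative stored as a vector. Vector-valued
    maps are differentiated coordinate by coordinate, so the product and sum rules are needed for
    scalar functions only. *)
Definition is_grad {a} (f : Vec a -> R) (x c : Vec a) : Prop :=
  forall eps, 0 < eps -> exists del, 0 < del /\ forall y, norm (vsub y x) < del ->
    Rabs (f y - f x - dot c (vsub y x)) <= eps * norm (vsub y x).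

Lemma is_grad_local {a} (f f' : Vec a -> R) x c r : 0 < r ->
  (forall y, norm (vsub y x) < r -> f y = f' y) -> is_grad f x c -> is_grad f' x c.
Proof.
move=> r0 e H eps /H [del [del0 Hd]]; exists (Rmin del r); split; first exact: Rmin_pos.
move=> y lt; have ltd := Rlt_le_trans _ _ _ lt (Rmin_l _ _).
rewrite -e; last exact: Rlt_le_trans lt (Rmin_r _ _).
by rewrite -e; [exact: Hd|rewrite norm_self].
Qed.

Lemma is_grad_unique {a} (f : Vec a -> R) x c c' : is_grad f x c -> is_grad f x c' -> c = c'.
Proof.
move=> H H'; pose w := vsub c c'.
have w0 := norm_ge0 w.
suff /norm_eq0 e : norm w = 0.
  apply: functional_extensionality => i.
  by have := f_equal (fun v : Vec a => v i) e; rewrite /w /vsub /vzero; lra.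
apply: Rle_antisym => //; apply: le_epsilon => eps eps0; rewrite Rplus_0_l.
have e2 : 0 < eps / 2 by lra.
have [d [d0 Hd]] := H _ e2; have [d' [d'0 Hd']] := H' _ e2.
have m0 := Rmin_pos _ _ d0 d'0.
(* Both expansions are tested at [x + s w] along the difference [w] of the two gradients; [s] keeps
   this point within both radii. *)
set s := Rmin d d' / (2 * (norm w + 1)).
have s0 : 0 < s by apply: Rdiv_lt_0_compat; lra.
have ey : vsub (vadd x (vscale s w)) x = vscale s w by vring.
have ny : norm (vsub (vadd x (vscale s w)) x) = s * norm w.
  by rewrite ey norm_scale Rabs_pos_eq //; lra.
have lt : s * norm w < Rmin d d'.
  have : s * (2 * (norm w + 1)) = Rmin d d' by rewrite /s; field; lra.
  by nra.
have lt1 := Rlt_le_trans _ _ _ lt (Rmin_l _ _).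
have lt2 := Rlt_le_trans _ _ _ lt (Rmin_r _ _).
have := Hd (vadd x (vscale s w)); have := Hd' (vadd x (vscale s w)).
rewrite ny ey => /(_ lt2) A /(_ lt1) B.
have : dot w (vscale s w) <= eps * (s * norm w).
  rewrite {1}/w dotBl; move: A B; move: (f _ - f x) => z.
  by split_Rabs; lra.
rewrite dotZr -norm_sq => {}H.
apply: Rnot_lt_le => lt3.
have : 0 < s * norm w * (norm w - eps) by apply: Rmult_lt_0_compat; nra.
by lra.
Qed.

Lemma fderiv_is_grad {a b} (f : Vec a -> Vec b) x L mu : is_fderiv f x L ->
  is_grad (fun y => dot mu (f y)) x (adj L mu).
Proof.
move=> [Llin H] eps eps0; have m0 := norm_ge0 mu.
have e0 : 0 < eps / (norm mu + 1) by apply: Rdiv_lt_0_compat; lra.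
have [d [d0 Hd]] := H _ e0; exists d; split=> // y /Hd le.
rewrite -dot_adj // -!dotBr; apply: (Rle_trans _ _ _ (dot_abs_le _ _)).
have e : eps = (norm mu + 1) * (eps / (norm mu + 1)) by field; lra.
have := norm_ge0 (vsub y x).
move: le (norm_ge0 (vsub (vsub (f y) (f x)) (L (vsub y x)))) => le p n0.
rewrite e Rmult_assoc; nra.
Qed.

Lemma is_grad_coord {a b} (f : Vec a -> Vec b) x L i : is_fderiv f x L ->
  is_grad (fun y => f y i) x (adj L (basis i)).
Proof.
move=> /(@fderiv_is_grad _ _ _ _ _ (basis i)).
apply: (@is_grad_local _ _ _ _ _ 1) => [|y _]; first lra.
exact: dot_basis.
Qed.

Lemma grads_is_fderiv {a b} (f : Vec a -> Vec b) x L : is_linear L ->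
  (forall i, is_grad (fun y => f y i) x (adj L (basis i))) -> is_fderiv f x L.
Proof.
move=> Llin H; split=> // eps eps0; have b0 := pos_INR b.
have e0 : 0 < eps / (INR b + 1) by apply: Rdiv_lt_0_compat; lra.
have [||d [d0 Hd]] := @finite_pos b (fun i d => forall y, norm (vsub y x) < d ->
    Rabs (f y i - f x i - dot (adj L (basis i)) (vsub y x)) <=
      eps / (INR b + 1) * norm (vsub y x)).
- by move=> i d d' le Hd y lt; apply: Hd; lra.
- by move=> i; exact: H.
exists d; split=> // y lt; have y0 := norm_ge0 (vsub y x).
apply: (Rle_trans _ (INR b * (eps / (INR b + 1) * norm (vsub y x)))).
  apply: norm_le_coord => [|i]; first by nra.
  have := Hd i y lt; rewrite -dot_adj // dot_basis; exact.
have e : eps = (INR b + 1) * (eps / (INR b + 1)) by field; lra.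
rewrite {2}e Rmult_assoc; nra.
Qed.

Lemma grads_fderivable {a b} (f : Vec a -> Vec b) x :
  (forall i, exists c, is_grad (fun y => f y i) x c) -> exists L, is_fderiv f x L.
Proof.
move=> /(_ _)/constructive_indefinite_description c.
exists (fun v i => dot (sval (c i)) v); apply: grads_is_fderiv.
  split=> [y z|t y]; apply: functional_extensionality => i; first exact: dotDr.
  by rewrite dotZr.
move=> i; have -> : adj (fun v i => dot (sval (c i)) v) (basis i) = sval (c i).
  apply: functional_extensionality => j.
  by rewrite /adj (dot_basis (fun i => _)) dotC dot_basis.
exact: (svalP (c i)).
Qed.

Lemma is_fderiv_unique {a b} (f : Vec a -> Vec b) x L L' :
  is_fderiv f x L -> is_fderiv f x L' -> L = L'.
Proof.
move=> H H'; apply: linear_ext; [by case: H|by case: H'|move=> i].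
exact: is_grad_unique (is_grad_coord f x L i H) (is_grad_coord f x L' i H').
Qed.

Lemma fderivP {a b} (f : Vec a -> Vec b) x L : is_fderiv f x L -> is_fderiv f x (fderiv f x).
Proof.
move=> H; rewrite /fderiv; case: excluded_middle_informative => [ex|[]]; last by exists L.
exact: (svalP (constructive_indefinite_description _ ex)).
Qed.

Lemma fderivE {a b} (f : Vec a -> Vec b) x L : is_fderiv f x L -> fderiv f x = L.
Proof. by move=> H; apply: is_fderiv_unique (fderivP f x L H) H. Qed.

Lemma is_fderiv_local {a b} (f f' : Vec a -> Vec b) x L r : 0 < r ->
  (forall y, norm (vsub y x) < r -> f y = f' y) -> is_fderiv f x L -> is_fderiv f' x L.
Proof.
move=> r0 e H; apply: grads_is_fderiv => [|i]; first by case: H.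
by apply: (is_grad_local (fun y => f y i) _ x _ r) (is_grad_coord f x L i H) => // y /e ->.
Qed.

Lemma is_fderiv_lip {a b} (f : Vec a -> Vec b) x L : is_fderiv f x L ->
  exists M del, 0 <= M /\ 0 < del /\
    forall y, norm (vsub y x) < del -> norm (vsub (f y) (f x)) <= M * norm (vsub y x).
Proof.
move=> [/linear_bound [M [M0 HM]] H]; have [d [d0 Hd]] := H 1 Rlt_0_1.
exists (M + 1), d; split; [lra|split=> // y /Hd le].
have -> : vsub (f y) (f x) =
  vadd (vsub (vsub (f y) (f x)) (L (vsub y x))) (L (vsub y x)) by vring.
have := HM (vsub y x).
by have := norm_add (vsub (vsub (f y) (f x)) (L (vsub y x))) (L (vsub y x)); lra.
Qed.

Lemma is_grad_lip {a} (f : Vec a -> R) x c : is_grad f x c ->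
  exists M del, 0 <= M /\ 0 < del /\
    forall y, norm (vsub y x) < del -> Rabs (f y - f x) <= M * norm (vsub y x).
Proof.
move=> H; have [d [d0 Hd]] := H 1 Rlt_0_1; have c0 := norm_ge0 c.
exists (norm c + 1), d; split; [lra|split=> // y /Hd].
by have := dot_abs_le c (vsub y x); split_Rabs; lra.
Qed.

Lemma is_grad_chain {a b} (f : Vec b -> R) (g : Vec a -> Vec b) x c L :
  is_grad f (g x) c -> is_fderiv g x L -> is_grad (fun y => f (g y)) x (adj L c).
Proof.
move=> Hf Hg eps eps0; have [M [dl [M0 [dl0 Hl]]]] := is_fderiv_lip g x L Hg.
have e1 : 0 < eps / (2 * (M + 1)) by apply: Rdiv_lt_0_compat; lra.
have [d1 [d10 H1]] := Hf _ e1.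
have e2 : 0 < eps / 2 by lra.
have [d2 [d20 H2]] := fderiv_is_grad g x L c Hg _ e2.
have d30 : 0 < d1 / (M + 1) by apply: Rdiv_lt_0_compat; lra.
exists (Rmin dl (Rmin d2 (d1 / (M + 1)))); split; first by do 2! apply: Rmin_pos => //.
move=> y /Rmin_Rgt_l [/Rgt_lt /Hl lip /Rmin_Rgt_l [/Rgt_lt /H2 le2 /Rgt_lt lt]].
have y0 := norm_ge0 (vsub y x).
have {}lt : norm (vsub (g y) (g x)) < d1.
  have : d1 = (M + 1) * (d1 / (M + 1)) by field; lra.
  by nra.
have le1 := H1 _ lt.
have e : eps / (2 * (M + 1)) * norm (vsub (g y) (g x)) <= eps / 2 * norm (vsub y x).
  have -> : eps / 2 * norm (vsub y x) =
    eps / (2 * (M + 1)) * ((M + 1) * norm (vsub y x)) by field; lra.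
  by apply: Rmult_le_compat_l; lra.
move: le1 le2; rewrite dotBr.
by split_Rabs; lra.
Qed.

Lemma is_fderiv_chain {a b c} (f : Vec b -> Vec c) (g : Vec a -> Vec b) x Lf Lg :
  is_fderiv f (g x) Lf -> is_fderiv g x Lg ->
  is_fderiv (fun y => f (g y)) x (fun v => Lf (Lg v)).
Proof.
move=> Hf Hg; have [[fD fZ] _] := Hf; have [[gD gZ] _] := Hg.
apply: grads_is_fderiv => [|i].
  by split=> [y z|t y]; rewrite ?gD ?fD ?gZ ?fZ.
have -> : adj (fun v => Lf (Lg v)) (basis i) = adj Lg (adj Lf (basis i)).
  by apply: functional_extensionality => j; rewrite {1}/adj dot_adj //; case: Hf.
exact: is_grad_chain (is_grad_coord f (g x) Lf i Hf) Hg.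
Qed.

Lemma is_grad_mul {a} (f g : Vec a -> R) x c c' : is_grad f x c -> is_grad g x c' ->
  is_grad (fun y => f y * g y) x (vadd (vscale (g x) c) (vscale (f x) c')).
Proof.
move=> Hf Hg eps eps0.
have [M [df [M0 [df0 lf]]]] := is_grad_lip f x c Hf.
have [M' [dg [M'0 [dg0 lg]]]] := is_grad_lip g x c' Hg.
have af := Rabs_pos (f x); have ag := Rabs_pos (g x).
have e1 : 0 < eps / (3 * (Rabs (g x) + 1)) by apply: Rdiv_lt_0_compat; lra.
have e2 : 0 < eps / (3 * (Rabs (f x) + 1)) by apply: Rdiv_lt_0_compat; lra.
have [d1 [d10 H1]] := Hf _ e1; have [d2 [d20 H2]] := Hg _ e2.
have MM : 0 <= M * M' by nra.
have d30 : 0 < eps / (3 * (M * M' + 1)) by apply: Rdiv_lt_0_compat; lra.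
exists (Rmin (Rmin df dg) (Rmin (Rmin d1 d2) (eps / (3 * (M * M' + 1))))); split.
  by do ! apply: Rmin_pos => //.
move=> y /Rmin_Rgt_l [/Rmin_Rgt_l [/lf {}lf /lg {}lg]].
move=> /Rmin_Rgt_l [/Rmin_Rgt_l [/H1 {}H1 /H2 {}H2] lt].
have y0 := norm_ge0 (vsub y x).
rewrite dotDl !dotZl; move: lf lg H1 H2 lt y0.
move: (norm _) (dot c _) (dot c' _) => t p p' lf lg H1 H2 lt t0.
have -> : f y * g y - f x * g x - (g x * p + f x * p') =
  (f y - f x - p) * g x + (f x * (g y - g x - p') + (f y - f x) * (g y - g x)) by ring.
apply: (Rle_trans _ _ _ (Rabs_triang _ _)).
apply: (Rle_trans _ (eps / 3 * t + (eps / 3 * t + eps / 3 * t))); last by lra.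
apply: Rplus_le_compat.
  rewrite Rabs_mult.
  have -> : eps / 3 * t = eps / (3 * (Rabs (g x) + 1)) * t * (Rabs (g x) + 1) by field; lra.
  by have := Rabs_pos (f y - f x - p); nra.
apply: (Rle_trans _ _ _ (Rabs_triang _ _)); apply: Rplus_le_compat.
  rewrite Rabs_mult.
  have -> : eps / 3 * t = (Rabs (f x) + 1) * (eps / (3 * (Rabs (f x) + 1)) * t) by field; lra.
  by have := Rabs_pos (g y - g x - p'); nra.
rewrite Rabs_mult.
apply: (Rle_trans _ ((M * t) * (M' * t))).
  by apply: Rmult_le_compat => //; exact: Rabs_pos.
have -> : eps / 3 * t = (M * M' + 1) * (eps / (3 * (M * M' + 1))) * t by field; lra.
have -> : M * t * (M' * t) = M * M' * t * t by ring.
by apply: Rmult_le_compat_r => //; move: lt => /Rgt_lt lt; nra.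
Qed.

Lemma is_grad_add {a} (f g : Vec a -> R) x c c' : is_grad f x c -> is_grad g x c' ->
  is_grad (fun y => f y + g y) x (vadd c c').
Proof.
move=> Hf Hg eps eps0; have e2 : 0 < eps / 2 by lra.
have [d1 [d10 H1]] := Hf _ e2; have [d2 [d20 H2]] := Hg _ e2.
exists (Rmin d1 d2); split; first exact: Rmin_pos.
move=> y /Rmin_Rgt_l [/H1 {}H1 /H2 {}H2]; rewrite dotDl.
by move: H1 H2; split_Rabs; lra.
Qed.

Lemma is_grad_const {a} (x : Vec a) (k : R) : is_grad (fun _ => k) x vzero.
Proof.
move=> eps eps0; exists 1; split=> [|y _]; first lra.
rewrite dot0l Rminus_diag Rminus_0_r Rabs_R0.
by have := norm_ge0 (vsub y x); nra.
Qed.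

Lemma sum_has_grad {a b} (F : 'I_b -> Vec a -> R) x :
  (forall j, exists c, is_grad (F j) x c) ->
  exists c, is_grad (fun y => \big[Rplus/0]_(j < b) F j y) x c.
Proof.
elim: b F => [|b IH] F H.
  exists vzero; apply: (@is_grad_local _ (fun _ => 0) _ _ _ 1) (is_grad_const x 0) => [|y _].
    lra.
  by rewrite big_ord0.
have [c Hc] := H ord0; have [c' Hc'] := IH (fun j => F (lift ord0 j)) (fun j => H _).
exists (vadd c c').
apply: (@is_grad_local _ _ _ _ _ 1) (is_grad_add _ _ x c c' Hc Hc') => [|y _]; first lra.
by rewrite big_ord_recl.
Qed.

Lemma line_derivable {a} (f : Vec a -> R) (x w c : Vec a) (t : R) :
  is_grad f (vadd x (vscale t w)) c ->
  derivable_pt_lim (fun s => f (vadd x (vscale s w))) t (dot c w).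
Proof.
move=> H eps eps0; have w0 := norm_ge0 w.
have e0 : 0 < eps / (2 * (norm w + 1)) by apply: Rdiv_lt_0_compat; lra.
have [d [d0 Hd]] := H _ e0.
have d1 : 0 < d / (norm w + 1) by apply: Rdiv_lt_0_compat; lra.
exists (mkposreal _ d1) => k k0 /= lt; have ak := Rabs_pos_lt _ k0.
have := Hd (vadd x (vscale (t + k) w)).
have -> : vsub (vadd x (vscale (t + k) w)) (vadd x (vscale t w)) = vscale k w by vring.
rewrite norm_scale dotZr => le.
have {}lt : Rabs k * norm w < d.
  have : d = d / (norm w + 1) * (norm w + 1) by field; lra.
  by nra.
have {le}lt2 := le lt; set D := f _ - f _ in lt2 *.
have -> : D / k - dot c w = (D - k * dot c w) / k by field.
rewrite {1}/Rdiv Rabs_mult Rabs_inv; apply: (Rmult_lt_reg_r (Rabs k)) => //.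
have -> : Rabs (D - k * dot c w) * / Rabs k * Rabs k = Rabs (D - k * dot c w) by field; lra.
apply: (Rle_lt_trans _ _ _ lt2).
have -> : eps * Rabs k = eps / (2 * (norm w + 1)) * (Rabs k * (2 * (norm w + 1))) by field; lra.
by apply: Rmult_lt_compat_l => //; nra.
Qed.

(** The mean value theorem for s |-> f(x + s w) - s <c x, w> - s^2 <Lam w, w> / 2 on [0, 1]: its
    derivative is the first-order remainder of the gradient field at [x], paired with [w]. *)
Lemma taylor_young {a} (f : Vec a -> R) (c Lam : Vec a -> Vec a) (x : Vec a) (r : R) :
  0 < r -> (forall y, norm (vsub y x) < r -> is_grad f y (c y)) -> is_fderiv c x Lam ->
  forall eps, 0 < eps -> exists del, 0 < del /\ forall y, norm (vsub y x) < del ->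
    Rabs (f y - f x - dot (c x) (vsub y x) - dot (Lam (vsub y x)) (vsub y x) / 2) <=
      eps * (norm (vsub y x) * norm (vsub y x)).
Proof.
move=> r0 gr [[LD LZ] Hc] eps eps0; have [d [d0 Hd]] := Hc eps eps0.
exists (Rmin r d); split; first exact: Rmin_pos.
move=> y /Rmin_Rgt_l [/Rgt_lt ltr /Rgt_lt ltd].
set w := vsub y x in ltr ltd *; have w0 := norm_ge0 w.
pose B := dot (c x) w; pose Q := dot (Lam w) w.
pose phi := fun s => f (vadd x (vscale s w)) - (s * B + s * s * (Q / 2)).
pose phi' := fun s => dot (c (vadd x (vscale s w))) w - (B + s * Q).
have dist s : norm (vsub (vadd x (vscale s w)) x) = Rabs s * norm w.
  by rewrite -norm_scale; congr norm; vring.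
have [s1 s01|s [e [s0 s1]]] := MVT_cor2 phi phi' 0 1 Rlt_0_1.
  apply: derivable_pt_lim_minus.
    by apply: line_derivable; apply: gr; rewrite dist Rabs_pos_eq; nra.
  have -> : B + s1 * Q = (1 * B + s1 * 0) + ((1 * s1 + s1 * 1) * (Q / 2) + s1 * s1 * 0) by field.
  apply: (derivable_pt_lim_plus (fun s => s * B) (fun s => s * s * (Q / 2))).
    apply: (derivable_pt_lim_mult id (fun _ => B)); first exact: derivable_pt_lim_id.
    exact: derivable_pt_lim_const.
  apply: (derivable_pt_lim_mult (fun s => s * s) (fun _ => Q / 2)).
    apply: (derivable_pt_lim_mult id id); exact: derivable_pt_lim_id.
  exact: derivable_pt_lim_const.
have -> : f y - f x - dot (c x) w - dot (Lam w) w / 2 = phi' s.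
  move: e; rewrite /phi.
  have -> : vadd x (vscale 1 w) = y by rewrite /w; vring.
  have -> : vadd x (vscale 0 w) = x by vring.
  by rewrite -/B -/Q; lra.
have -> : phi' s =
    dot (vsub (vsub (c (vadd x (vscale s w))) (c x)) (Lam (vsub (vadd x (vscale s w)) x))) w.
  have -> : vsub (vadd x (vscale s w)) x = vscale s w by vring.
  by rewrite LZ 2!dotBl dotZl /phi' /B /Q; ring.
apply: (Rle_trans _ _ _ (dot_abs_le _ _)); rewrite -Rmult_assoc.
apply: Rmult_le_compat_r => //.
have ds := dist s; rewrite Rabs_pos_eq in ds; last lra.
have lts : norm (vsub (vadd x (vscale s w)) x) < d by rewrite ds; nra.
apply: (Rle_trans _ _ _ (Hd _ lts)); rewrite ds.
have : 0 <= eps * norm w * (1 - s) by apply: Rmult_le_pos; nra.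
by lra.
Qed.

Lemma linear_coord {a b} (L : Vec a -> Vec b) x i : is_linear L ->
  L x i = \big[Rplus/0]_(j < a) (x j * L (basis j) i).
Proof.
move=> Ll; rewrite -dot_basis dot_adj // dotC; apply: eq_bigr => j _.
by rewrite /adj dot_basis.
Qed.

(** The first derivative is [Dh (g y) (Dg y v)], where [y] enters both the operator and its
    argument. Expanding the argument in the standard basis separates the two occurrences: each
    coordinate becomes a finite sum of products of differentiable scalar functions. The radius [rho]
    also keeps [g y] inside [V]. *)
Lemma comp_twice_fderivable {a b e} (g : Vec a -> Vec b) (h : Vec b -> Vec e)
    (V : Vec b -> Prop) (z : Vec a) (r : R) :
  0 < r -> C2_on (ball z r) g -> is_open V -> V (g z) -> C2_on V h ->
  exists rho, 0 < rho /\
    (forall y, norm (vsub y z) < rho ->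
       V (g y) /\ is_fderiv (fun x => h (g x)) y (fderiv (fun x => h (g x)) y)) /\
    forall v, is_fderiv (fun y => fderiv (fun x => h (g x)) y v) z (hess (fun x => h (g x)) z v).
Proof.
move=> r0 [Dg [D2g [Hg [Hg2 _]]]] oV Vg [Dh [D2h [Hh [Hh2 _]]]].
have Bz : ball z r z by rewrite /ball norm_self.
have [s [s0 sV]] := oV _ Vg.
have [M [dl [M0 [dl0 Hl]]]] := is_fderiv_lip g z _ (Hg z Bz).
have s1 : 0 < s / (M + 1) by apply: Rdiv_lt_0_compat; lra.
pose rho := Rmin r (Rmin dl (s / (M + 1))).
have near y : norm (vsub y z) < rho -> ball z r y /\ V (g y).
  move=> /Rmin_Rgt_l [/Rgt_lt ltr /Rmin_Rgt_l [/Rgt_lt /Hl le /Rgt_lt lts]].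
  split=> //; apply: sV; rewrite /ball.
  have : s = (M + 1) * (s / (M + 1)) by field; lra.
  by have := norm_ge0 (vsub y z); nra.
have der y : norm (vsub y z) < rho ->
    is_fderiv (fun x => h (g x)) y (fun v => Dh (g y) (Dg y v)).
  by move=> /near [By Vy]; apply: is_fderiv_chain (Hh _ Vy) (Hg _ By).
have rho0 : 0 < rho by do 2! apply: Rmin_pos => //.
exists rho; split=> //; split=> [y lt|v].
  by split; [case: (near y lt)|exact: fderivP (der y lt)].
rewrite /hess.
have [|L HL] := @grads_fderivable _ _ (fun y => fderiv (fun x => h (g x)) y v) z; last first.
  exact: fderivP HL.
move=> i.
have [j|c Hc] := @sum_has_grad _ b (fun j y => Dg y v j * Dh (g y) (basis j) i) z.
  eexists; apply: (is_grad_mul (fun y => Dg y v j) (fun y => Dh (g y) (basis j) i)).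
    exact: (is_grad_coord (fun y => Dg y v) z _ j (Hg2 z v Bz)).
  apply: (is_grad_chain (fun y => Dh y (basis j) i) g).
    exact: (is_grad_coord (fun y => Dh y (basis j)) (g z) _ i (Hh2 (g z) (basis j) Vg)).
  exact: Hg.
exists c; apply: is_grad_local rho0 _ Hc => y lt.
have [By Vy] := near y lt.
rewrite (fderivE _ _ _ (der y lt)) [RHS]linear_coord //; by case: (Hh _ Vy).
Qed.

(** As linear forms in [w], both sides of the identity are the derivative at [z] of y |-> <mu, Df(y)
    v>, so uniqueness of gradients identifies them. In [hess f z v w] the second differentiation is
    along [w]. *)
Lemma adj_field_fderiv {a b} (f : Vec a -> Vec b) (z : Vec a) (r : R) (mu : Vec b) : 0 < r ->
  (forall y, norm (vsub y z) < r -> is_fderiv f y (fderiv f y)) ->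
  (forall v, is_fderiv (fun y => fderiv f y v) z (hess f z v)) ->
  exists Lam, is_fderiv (fun y => adj (fderiv f y) mu) z Lam /\
    forall v w, dot (Lam w) v = dot mu (hess f z v w).
Proof.
move=> r0 d1 d2.
have [j|Lam HL] := @grads_fderivable _ _ (fun y => adj (fderiv f y) mu) z.
  by eexists; apply: (fderiv_is_grad (fun y => fderiv f y (basis j)) z _ mu (d2 (basis j))).
exists Lam; split=> // v w; rewrite dotC.
rewrite (@dot_adj _ _ Lam v w); last by case: HL.
rewrite (@dot_adj _ _ (hess f z v) mu w); last by case: (d2 v).
congr dot; apply: is_grad_unique (fderiv_is_grad _ _ _ v HL) _.
apply: is_grad_local r0 _ (fderiv_is_grad _ _ _ mu (d2 v)) => y lt.
by rewrite (dotC v) dot_adj //; case: (d1 y lt).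
Qed.

Lemma vpair_is_fderiv {m n} (p : Vec m) (x : Vec n) :
  is_fderiv (fun y => vpair p y) x (fun y => vpair vzero y).
Proof.
have vv : vsub p p = vzero by vring.
split=> [|eps eps0].
  split=> [y y'|c y]; rewrite ?vpair_add ?vpair_scale; congr vpair; vring.
exists 1; split=> [|y _]; first lra.
by rewrite vpair_sub vv norm_self; have := norm_ge0 (vsub y x); nra.
Qed.

Lemma pderiv_xE {m n b} (f : Vec (m + n) -> Vec b) z L : is_fderiv f z L ->
  pderiv_x f z = fun e => L (vpair vzero e).
Proof.
rewrite -{1}(vpair_eta z) => H; apply: fderivE.
exact: is_fderiv_chain H (vpair_is_fderiv _ _).
Qed.

Lemma basis_rshift {m n} (j : 'I_n) : basis (rshift m j) = vpair vzero (basis j).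
Proof.
apply: functional_extensionality => i; rewrite /basis /vpair.
case: fintype.splitP => k e; rewrite -val_eqE /= e //.
by rewrite ltn_eqF // (leq_trans (ltn_ord k)) // leq_addr.
by rewrite eqn_add2l.
Qed.

Lemma adj_pderiv_x {m n b} (f : Vec (m + n) -> Vec b) z L mu : is_fderiv f z L ->
  adj (pderiv_x f z) mu = vsnd (adj L mu).
Proof.
move=> H; apply: functional_extensionality => j.
by rewrite /adj /vsnd (pderiv_xE f z L H) basis_rshift.
Qed.

Lemma vsnd_is_fderiv {a m n} (F : Vec a -> Vec (m + n)) x L : is_fderiv F x L ->
  is_fderiv (fun y => vsnd (F y)) x (fun v => vsnd (L v)).
Proof.
move=> [[LD LZ] H]; split.
  by split=> [y y'|c y]; rewrite ?LD ?LZ.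
move=> eps /H [d [d0 Hd]]; exists d; split=> // y /Hd; apply: Rle_trans.
exact: (norm_vsnd_le (vsub (vsub (F y) (F x)) (L (vsub y x)))).
Qed.

(** Replaces the second-order term of the theorem by the X*-component of the derivative [Lam] of the
    full gradient field, which is what the construction of normals controls. *)
Lemma adj_pderiv_x_fderiv {m n b} (f : Vec (m + n) -> Vec b) z r mu Lam : 0 < r ->
  (forall y, norm (vsub y z) < r -> is_fderiv f y (fderiv f y)) ->
  is_fderiv (fun y => adj (fderiv f y) mu) z Lam ->
  fderiv (fun y => adj (pderiv_x f y) mu) z = fun v => vsnd (Lam v).
Proof.
move=> r0 d1 H; apply: fderivE.
by apply: is_fderiv_local r0 _ (vsnd_is_fderiv _ _ _ H) => y /d1 /adj_pderiv_x ->.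
Qed.

(** * Asymptotic conic duality *)

(* The point [(-b, - dot mu b)] lies in the closure of the cone
   [{(A s - k, dot zs s - r) | k in K, r >= 0}]: a separating functional would be a multiplier
   with a larger objective value, or a recession direction increasing it. *)
Lemma approximate_dual {N d} (A : Vec N -> Vec d) (K : Vec d -> Prop) zs b mu :
  is_linear A -> additive_cone K -> polar K mu -> adj A mu = zs ->
  (forall mu', polar K mu' -> adj A mu' = zs -> dot mu' b <= dot mu b) ->
  forall eps, 0 < eps -> exists s k, K k /\ norm (vsub (vadd (A s) b) k) <= eps /\
    - dot mu b - eps <= dot zs s.
Proof.
move=> Al [[K0 KZ] KD] Kmu muA opt eps eps0; apply: NNPP => no.
have [AD AZ] := Al; have A0 := linear0 A Al.
pose pt (x : Vec d) (c : R) : Vec (d + 1) := vpair x (fun _ : 'I_1 => c).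
pose Q y := exists s k r, K k /\ 0 <= r /\ y = pt (vsub (A s) k) (dot zs s - r).
have ptE nu x c : dot nu (pt x c) = dot (vfst nu) x + vsnd nu ord0 * c.
  by rewrite -{1}(vpair_eta nu) dot_vpair {2}/dot big_ord1.
have Qc : additive_cone Q.
  split; first split.
  - exists vzero, vzero, 0; split=> //; split; first lra.
    by apply: functional_extensionality => i; rewrite /pt /vpair A0 dot0r /vzero /vsub;
       case: fintype.split => ?; ring.
  - move=> t _ t0 [s [k [r [Kk [r0 ->]]]]]; exists (vscale t s), (vscale t k), (t * r).
    split; first exact: KZ.
    split; first by nra.
    rewrite /pt vpair_scale AZ dotZr; congr vpair; first by vring.
    by apply: functional_extensionality => i; rewrite /vscale; ring.
  - move=> _ _ [s [k [r [Kk [r0 ->]]]]] [s' [k' [r' [Kk' [r'0 ->]]]]].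
    exists (vadd s s'), (vadd k k'), (r + r'); split; first exact: KD.
    split; first lra.
    rewrite /pt vpair_add AD dotDr; congr vpair; first by vring.
    by apply: functional_extensionality => i; rewrite /vadd; ring.
have [_ [s [k [r [Kk [r0 ->]]]]]|nu [nup nuQ]] :=
    cone_separation Q (pt (vscale (-1) b) (- dot mu b)) eps Qc eps0.
  (* A point of [Q] closer than [eps] would provide the [s] and [k] sought: the first block gives
     the norm bound, and since [r >= 0] the last coordinate gives the one-sided bound on <zs, s>. *)
  apply: Rnot_lt_le => lt; apply: no; exists s, k; split=> //.
  rewrite /pt vpair_sub in lt; split.
    have -> : vsub (vadd (A s) b) k = vscale (-1) (vsub (vscale (-1) b) (vsub (A s) k)) by vring.
    rewrite norm_scale Rabs_Ropp Rabs_R1 Rmult_1_l.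
    by have := norm_vfst_le (vpair (vsub (vscale (-1) b) (vsub (A s) k))
      (vsub (fun _ : 'I_1 => - dot mu b) (fun _ => dot zs s - r))); rewrite vfst_pair; lra.
  have := norm_vsnd_le (vpair (vsub (vscale (-1) b) (vsub (A s) k))
      (vsub (fun _ : 'I_1 => - dot mu b) (fun _ => dot zs s - r))); rewrite vsnd_pair => le.
  have := coord_le_norm (vsub (fun _ : 'I_1 => - dot mu b) (fun _ => dot zs s - r)) ord0.
  by rewrite {1}/vsub; split_Rabs; lra.
rewrite ptE dotZr in nup.
set nu1 := vfst nu in nup; set tau := vsnd nu ord0 in nup.
(* Separation, tested on the generators of [Q] one at a time, says that [- nu1] is polar to [K],
   that [tau >= 0], and that [adj A nu1] is [- tau zs]. The competing multiplier is then
   [- nu1 / tau] if [tau > 0] and [mu - nu1] if [tau = 0]. *)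
have key s k r : K k -> 0 <= r -> dot nu1 (A s) - dot nu1 k + tau * (dot zs s - r) <= 0.
  by move=> Kk r0; rewrite -dotBr -ptE; apply: nuQ; exists s, k, r.
have pol k : K k -> 0 <= dot nu1 k.
  by move=> Kk; have := key vzero k 0 Kk (Rle_refl 0); rewrite A0 !dot0r; lra.
have tau0 : 0 <= tau by have := key vzero vzero 1 K0; rewrite A0 !dot0r; lra.
have eqn s : dot nu1 (A s) = - tau * dot zs s.
  have := key s vzero 0 K0 (Rle_refl 0); have := key (vscale (-1) s) vzero 0 K0 (Rle_refl 0).
  by rewrite AZ !dotZr !dot0r; lra.
have zsE j : dot zs (basis j) = zs j by rewrite dotC dot_basis.
have muE j : dot mu (A (basis j)) = zs j by rewrite -muA.
have [tpos|t0] : 0 < tau \/ tau = 0 by lra.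
- have : dot (vscale (- / tau) nu1) b <= dot mu b.
    apply: opt => [k /pol le|].
      have := Rinv_0_lt_compat _ tpos; rewrite dotZl; nra.
    apply: functional_extensionality => j; rewrite /adj dotZl eqn zsE; field; lra.
  rewrite dotZl => le.
  have := Rmult_le_compat_l _ _ _ tau0 le.
  have -> : tau * (- / tau * dot nu1 b) = - dot nu1 b by field; lra.
  by lra.
- have : dot (vsub mu nu1) b <= dot mu b; last by rewrite dotBl; nra.
  apply: opt => [k Kk|]; first by rewrite dotBl; have := pol k Kk; have := Kmu k Kk; lra.
  by apply: functional_extensionality => j; rewrite /adj dotBl eqn muE t0; ring.
Qed.

(** * Metrically subregular conic systems *)

(** [S] is kept apart from the preimage of [K] under [G]: the graph of Gamma coincides with that
    preimage only near [zb], since h o g describes the constraint only where g takes values in [V].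
    Everything up to the graph of Psi depends on these local data alone. *)
Record conic_system {N d} (S : Vec N -> Prop) (K : Vec d -> Prop) (G : Vec N -> Vec d)
    (zb : Vec N) (r : R) : Prop := {
  cs_pos : 0 < r;
  cs_zero : G zb = vzero;
  cs_iff : forall y, norm (vsub y zb) < r -> (S y <-> K (G y));
  cs_der : forall y, norm (vsub y zb) < r -> is_fderiv G y (fderiv G y);
  cs_der2 : forall v, is_fderiv (fun y => fderiv G y v) zb (hess G zb v);
  cs_closed : is_closed K;
  cs_cone : additive_cone K;
  cs_mscq : MSCQ G K zb }.

Lemma cs_base {N d S K G zb r} (cs : @conic_system N d S K G zb r) :
  is_fderiv G zb (fderiv G zb).
Proof. by apply: (cs_der _ _ _ _ _ cs); rewrite norm_self; exact: cs_pos cs. Qed.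

Lemma cs_linear {N d S K G zb r} (cs : @conic_system N d S K G zb r) :
  is_linear (fderiv G zb).
Proof. by case: (cs_base cs). Qed.

(** The solutions supplied by MSCQ could a priori lie where the preimage of [K] differs from [S].
    Taking the radius at most r / 2 and requiring the error bound to stay below it keeps them in the
    ball of agreement. The slack [e] replaces a nearest point. *)
Lemma cs_sub {N d S K G zb r} (cs : @conic_system N d S K G zb r) :
  exists kappa rho, 0 <= kappa /\ 0 < rho /\ forall z k e, norm (vsub z zb) < rho -> K k ->
    0 < e -> kappa * norm (vsub (G z) k) + e < rho ->
    exists s, S s /\ norm (vsub s z) < kappa * norm (vsub (G z) k) + e.
Proof.
have r0 := cs_pos _ _ _ _ _ cs.
have [kap [rho [kap0 [rho0 H]]]] := cs_mscq _ _ _ _ _ cs.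
exists kap, (Rmin (r / 2) rho); split=> //; split; first by apply: Rmin_pos; lra.
move=> z k e /Rmin_Rgt_l [/Rgt_lt zr /Rgt_lt zrho] Kk e0 /Rmin_Rgt_l [/Rgt_lt lt _].
have [s [Ks ls]] := H z zrho k Kk e e0; exists s; rewrite norm_opp; split=> //.
apply/(cs_iff _ _ _ _ _ cs) => //.
by have := norm_tri z s zb; rewrite (norm_opp s z); lra.
Qed.

Lemma closed_approx {n} (S : Vec n -> Prop) x : is_closed S ->
  (forall e, 0 < e -> exists y, S y /\ norm (vsub y x) < e) -> S x.
Proof.
move=> cl H.
have /(_ _)/constructive_indefinite_description f := fun k => H _ (inv_succ_pos k).
apply: (cl (fun k => sval (f k))) => [k|e /inv_succ_small [N HN]]; first by case: (svalP (f k)).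
by exists N => k /HN; have [_] := svalP (f k); lra.
Qed.

Lemma cs_feasible_closed {N d S K G zb r} (cs : @conic_system N d S K G zb r) s l :
  (forall k, S (s k)) -> vconv s l -> norm (vsub l zb) < r -> S l.
Proof.
move=> Ss cv lr; apply/(cs_iff _ _ _ _ _ cs) => //.
apply: (closed_approx K _ (cs_closed _ _ _ _ _ cs)) => e e0.
have [M [dl [M0 [dl0 lip]]]] := is_fderiv_lip G l _ (cs_der _ _ _ _ _ cs l lr).
have e1 : 0 < e / (M + 1) by apply: Rdiv_lt_0_compat; lra.
have r1 : 0 < r - norm (vsub l zb) by lra.
have [n Hn] := cv _ (Rmin_pos _ _ dl0 (Rmin_pos _ _ e1 r1)).
have /Rmin_Rgt_l [/Rgt_lt /lip le /Rmin_Rgt_l [/Rgt_lt lt1 /Rgt_lt lt2]] := Hn n (leqnn n).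
exists (G (s n)); split.
  by apply/(cs_iff _ _ _ _ _ cs) => //; have := norm_tri l (s n) zb; lra.
have : e = (M + 1) * (e / (M + 1)) by field; lra.
by have := norm_ge0 (vsub (s n) l); nra.
Qed.

Lemma tangent_of_approx {n} (S : Vec n -> Prop) z v :
  (forall e, 0 < e -> exists t w, 0 < t < e /\ norm (vsub w v) < e /\
     S (vadd z (vscale t w))) -> tangent_cone S z v.
Proof.
move=> H.
have H' k : exists tw : R * Vec n, 0 < tw.1 < / (INR k + 1) /\
    norm (vsub tw.2 v) < / (INR k + 1) /\ S (vadd z (vscale tw.1 tw.2)).
  by have [t [w ?]] := H _ (inv_succ_pos k); exists (t, w).
have /(_ _)/constructive_indefinite_description f := H'.
exists (fun k => (sval (f k)).1), (fun k => (sval (f k)).2).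
split; first by move=> k; case: (svalP (f k)); lra.
split.
  move=> e /inv_succ_small [N HN]; exists N => k /leP /HN.
  by have [t0 _] := svalP (f k); rewrite /R_dist; split_Rabs; lra.
split; last by move=> k; case: (svalP (f k)) => _ [].
move=> e /inv_succ_small [N HN]; exists N => k /HN.
by have [_ [lt _]] := svalP (f k); lra.
Qed.

(** The points [G (zb + t w) / t] lie in the closed cone [K] and tend to the derivative of [G] along
    [v]. *)
Lemma tangent_linearized {N d S K G zb r} (cs : @conic_system N d S K G zb r) v :
  tangent_cone S zb v -> K (fderiv G zb v).
Proof.
move=> [t [w [t0 [tcv [wcv Sw]]]]].
apply: (closed_approx K _ (cs_closed _ _ _ _ _ cs)) => e e0.
have r0 := cs_pos _ _ _ _ _ cs; have Al := cs_linear cs.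
have [M [M0 HM]] := linear_bound _ Al; have v0 := norm_ge0 v.
have e1 : 0 < e / (2 * (norm v + 1)) by apply: Rdiv_lt_0_compat; lra.
have [_ /(_ _ e1) [dl [dl0 Hd]]] := cs_base cs.
have e2 : 0 < Rmin 1 (e / (2 * (M + 1))).
  by apply: Rmin_pos; [lra|apply: Rdiv_lt_0_compat; lra].
have e3 : 0 < Rmin dl r / (norm v + 1) by apply: Rdiv_lt_0_compat; [exact: Rmin_pos|lra].
have [n1 H1] := wcv _ e2; have [n2 H2] := tcv _ e3; pose n := maxn n1 n2.
have /Rmin_Rgt_l [/Rgt_lt lt1 /Rgt_lt ltM] := H1 n (leq_maxl _ _).
have := H2 n; rewrite /R_dist Rminus_0_r Rabs_pos_eq; last by have := t0 n; lra.
move=> /(_ (elimT leP (leq_maxr n1 n2))) ltt.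
move: (t0 n) (Sw n) lt1 ltM ltt; move: (t n) (w n) => tn wn {}t0 {}Sw lt1 ltM ltt.
have wn1 : norm wn <= norm v + 1.
  have -> : wn = vadd v (vsub wn v) by vring.
  by have := norm_add v (vsub wn v); lra.
have ey : vsub (vadd zb (vscale tn wn)) zb = vscale tn wn by vring.
have ny : norm (vsub (vadd zb (vscale tn wn)) zb) = tn * norm wn.
  by rewrite ey norm_scale Rabs_pos_eq //; lra.
have lt : tn * norm wn < Rmin dl r.
  have : Rmin dl r = Rmin dl r / (norm v + 1) * (norm v + 1) by field; lra.
  by have := norm_ge0 wn; nra.
have /Rmin_Rgt_l [/Rgt_lt ltd /Rgt_lt ltr] := lt.
exists (vscale (/ tn) (G (vadd zb (vscale tn wn)))); split.
  apply: (proj2 (proj1 (cs_cone _ _ _ _ _ cs))).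
    by apply: Rlt_le; exact: Rinv_0_lt_compat.
  by apply/(cs_iff _ _ _ _ _ cs) => //; rewrite ny.
have := Hd (vadd zb (vscale tn wn)); rewrite ny ey => /(_ ltd).
rewrite (cs_zero _ _ _ _ _ cs) (proj2 Al) => le.
have -> : vsub (vscale (/ tn) (G (vadd zb (vscale tn wn)))) (fderiv G zb v) =
    vadd (vscale (/ tn) (vsub (vsub (G (vadd zb (vscale tn wn))) vzero)
                              (vscale tn (fderiv G zb wn)))) (fderiv G zb (vsub wn v)).
  rewrite (linearB (fderiv G zb) wn v Al); apply: functional_extensionality => i.
  by rewrite /vadd /vsub /vscale /vzero; field; lra.
apply: (Rle_lt_trans _ _ _ (norm_add _ _)).
rewrite norm_scale Rabs_pos_eq; last by apply: Rlt_le; exact: Rinv_0_lt_compat.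
have A1 := Rmult_le_compat_l _ _ _ (Rlt_le _ _ (Rinv_0_lt_compat _ t0)) le.
have A2 : / tn * (e / (2 * (norm v + 1)) * (tn * norm wn)) <= e / 2.
  have -> : / tn * (e / (2 * (norm v + 1)) * (tn * norm wn)) =
    e / (2 * (norm v + 1)) * norm wn by field; lra.
  have -> : e / 2 = e / (2 * (norm v + 1)) * (norm v + 1) by field; lra.
  by nra.
have A3 := HM (vsub wn v).
have A4 : M * norm (vsub wn v) < e / 2.
  have : e / 2 = (M + 1) * (e / (2 * (M + 1))) by field; lra.
  by have := norm_ge0 (vsub wn v); nra.
by lra.
Qed.

(** The converse inclusion rests on MSCQ: [t A v] is in [K] and [G (zb + t v)] differs from it by
    o(t), so a point of [S] lies within o(t) of [zb + t v]. *)
Lemma linearized_tangent {N d S K G zb r} (cs : @conic_system N d S K G zb r) v :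
  K (fderiv G zb v) -> tangent_cone S zb v.
Proof.
move=> Kv; apply: tangent_of_approx => e e0; have Al := cs_linear cs.
have [kap [rho [kap0 [rho0 H]]]] := cs_sub cs; have v0 := norm_ge0 v.
have C0 : 0 < kap * norm v + 1 by nra.
have e1 : 0 < e / (kap * norm v + 1) by apply: Rdiv_lt_0_compat.
set e' := e / _ in e1.
have [_ /(_ _ e1) [dl [dl0 Hd]]] := cs_base cs.
pose t := Rmin (Rmin (e / 2) (rho / (2 * e))) (Rmin dl rho / (2 * (norm v + 1))).
have m0 := Rmin_pos _ _ dl0 rho0.
have t0 : 0 < t.
  by do ! apply: Rmin_pos; try apply: Rdiv_lt_0_compat; lra.
have te : t <= e / 2 by apply: Rle_trans (Rmin_l _ _) (Rmin_l _ _).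
have tr : t * e <= rho / 2.
  have : t <= rho / (2 * e) by apply: Rle_trans (Rmin_l _ _) (Rmin_r _ _).
  have -> : rho / 2 = rho / (2 * e) * e by field; lra.
  by nra.
have tm : t * (norm v + 1) <= Rmin dl rho / 2.
  have : t <= Rmin dl rho / (2 * (norm v + 1)) by exact: Rmin_r.
  have -> : Rmin dl rho / 2 = Rmin dl rho / (2 * (norm v + 1)) * (norm v + 1) by field; lra.
  by nra.
have ey : vsub (vadd zb (vscale t v)) zb = vscale t v by vring.
have ny : norm (vsub (vadd zb (vscale t v)) zb) = t * norm v.
  by rewrite ey norm_scale Rabs_pos_eq //; lra.
have /Rmin_Rgt_l [/Rgt_lt ltd /Rgt_lt ltr] : t * norm v < Rmin dl rho by nra.
have := Hd (vadd zb (vscale t v)); rewrite ny ey => /(_ ltd).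
have -> : vsub (vsub (G (vadd zb (vscale t v))) (G zb)) (fderiv G zb (vscale t v)) =
   vsub (G (vadd zb (vscale t v))) (vscale t (fderiv G zb v)).
  by rewrite (proj2 Al) (cs_zero _ _ _ _ _ cs); vring.
move=> le.
have K1 : K (vscale t (fderiv G zb v)).
  by apply: (proj2 (proj1 (cs_cone _ _ _ _ _ cs))) => //; lra.
have le2 : kap * norm (vsub (G (vadd zb (vscale t v))) (vscale t (fderiv G zb v))) + e' * t
    <= t * e.
  have -> : t * e = kap * (e' * (t * norm v)) + e' * t by rewrite /e'; field; lra.
  by have := Rmult_le_compat_l _ _ _ kap0 le; lra.
have [||||s [Ss ls]] := H (vadd zb (vscale t v)) (vscale t (fderiv G zb v)) (e' * t) => //.
- by rewrite ny.
- by nra.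
- by lra.
exists t, (vscale (/ t) (vsub s zb)); split; first lra.
split; last first.
  have -> : vadd zb (vscale t (vscale (/ t) (vsub s zb))) = s; last by [].
  by apply: functional_extensionality => i; rewrite /vadd /vsub /vscale; field; lra.
have -> : vsub (vscale (/ t) (vsub s zb)) v = vscale (/ t) (vsub s (vadd zb (vscale t v))).
  by apply: functional_extensionality => i; rewrite /vadd /vsub /vscale; field; lra.
have ti := Rinv_0_lt_compat _ t0.
rewrite norm_scale Rabs_pos_eq; last lra.
have -> : e = / t * (t * e) by field; lra.
by apply: Rmult_lt_compat_l => //; lra.
Qed.

(** Second-order expansion along parabolic arcs. Uniformity over [norm s <= M] matters because
    [recovery_arc] applies it to a correction that depends on [t]. *)
Lemma quadratic_expansion {N d S K G zb r} (cs : @conic_system N d S K G zb r) mu v (M eps : R) :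
  0 <= M -> 0 < eps -> exists del, 0 < del /\ forall t s, 0 < t < del -> norm s <= M ->
    Rabs (dot mu (G (vadd zb (vadd (vscale t v) (vscale (t * t) s))))
          - t * dot mu (fderiv G zb v)
          - t * t * (dot mu (fderiv G zb s) + dot mu (hess G zb v v) / 2)) <= eps * (t * t).
Proof.
move=> M0 eps0; have r0 := cs_pos _ _ _ _ _ cs; have v0 := norm_ge0 v.
have der := cs_der _ _ _ _ _ cs.
have [Lam [HL Lh]] := adj_field_fderiv G zb r mu r0 der (cs_der2 _ _ _ _ _ cs).
have [[LD LZ] _] := HL; have [ML [ML0 HML]] := linear_bound _ (proj1 HL).
pose B := norm v + M; have B0 : 0 <= B by rewrite /B; lra.
have e1 : 0 < eps / (2 * (B * B + 1)) by apply: Rdiv_lt_0_compat; nra.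
have gr y : norm (vsub y zb) < r -> is_grad (fun y => dot mu (G y)) y (adj (fderiv G y) mu).
  by move=> /der; exact: fderiv_is_grad.
have [dl [dl0 Hd]] := taylor_young (fun y => dot mu (G y)) _ Lam zb r r0 gr HL _ e1.
(* Bounds the coefficient of t^3 in <Lam x, x>, formed by the two mixed terms in [v] and [s] and by
   [t] times the pure [s] term, where t < 1. *)
pose C := ML * (2 * norm v * M + M * M).
have C0 : 0 <= C by apply: Rmult_le_pos; nra.
have d1 : 0 < dl / (B + 1) by apply: Rdiv_lt_0_compat; lra.
have d2 : 0 < eps / (C + 1) by apply: Rdiv_lt_0_compat; lra.
exists (Rmin 1 (Rmin (dl / (B + 1)) (eps / (C + 1)))); split.
  by do ! apply: Rmin_pos => //; lra.
move=> t s [t0 /Rmin_Rgt_l [/Rgt_lt t1 /Rmin_Rgt_l [/Rgt_lt tdl /Rgt_lt tC]]] sM.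
have s0 := norm_ge0 s.
set x := vadd (vscale t v) (vscale (t * t) s).
have ex : vsub (vadd zb x) zb = x by vring.
have nx : norm x <= t * B.
  apply: (Rle_trans _ _ _ (norm_add _ _)); rewrite !norm_scale !Rabs_pos_eq; try nra.
  have ts : t * norm s <= M by nra.
  by have := Rmult_le_compat_l t _ _ (Rlt_le _ _ t0) ts; rewrite /B; lra.
have x0 := norm_ge0 x.
have lt : norm x < dl.
  have : dl = dl / (B + 1) * (B + 1) by field; lra.
  by nra.
have := Hd (vadd zb x); rewrite ex => /(_ lt).
rewrite (cs_zero _ _ _ _ _ cs) dot0r -(dot_adj _ _ _ (cs_linear cs)).
have -> : dot mu (fderiv G zb x) =
    t * dot mu (fderiv G zb v) + t * t * dot mu (fderiv G zb s).
  by have [AD AZ] := cs_linear cs; rewrite /x AD !AZ dotDr !dotZr.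
have -> : dot (Lam x) x = t * t * dot mu (hess G zb v v)
    + t * t * t * (dot (Lam v) s + dot (Lam s) v + t * dot (Lam s) s).
  by rewrite /x LD !LZ !dotDl !dotDr !dotZl !dotZr -Lh; ring.
have q : eps / (2 * (B * B + 1)) * (norm x * norm x) <= eps / 2 * (t * t).
  have -> : eps / 2 * (t * t) = eps / (2 * (B * B + 1)) * ((B * B + 1) * (t * t)) by field; nra.
  apply: Rmult_le_compat_l; first lra.
  have : norm x * norm x <= (t * B) * (t * B) by apply: Rmult_le_compat.
  by nra.
have c : Rabs (dot (Lam v) s + dot (Lam s) v + t * dot (Lam s) s) <= C.
  have b (a a' : Vec N) (k k' : R) : norm a <= k -> norm a' <= k' ->
      Rabs (dot (Lam a) a') <= ML * (k * k').
    move=> ak ak'; apply: (Rle_trans _ _ _ (dot_abs_le _ _)).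
    have ge0 := norm_ge0 a; have ge0' := norm_ge0 a'.
    apply: (Rle_trans _ ((ML * norm a) * norm a')).
      by apply: Rmult_le_compat_r => //.
    have kk := Rmult_le_compat _ _ _ _ ge0 ge0' ak ak'.
    by have := Rmult_le_compat_l _ _ _ ML0 kk; lra.
  have b1 := b v s _ _ (Rle_refl _) sM; have b2 := b s v _ _ sM (Rle_refl _).
  have b3 := b s s _ _ sM sM.
  have b4 : Rabs (t * dot (Lam s) s) <= ML * (M * M).
    rewrite Rabs_mult Rabs_pos_eq; last lra.
    by have := Rabs_pos (dot (Lam s) s); nra.
  have := Rabs_triang (dot (Lam v) s + dot (Lam s) v) (t * dot (Lam s) s).
  by have := Rabs_triang (dot (Lam v) s) (dot (Lam s) v); rewrite /C; lra.
have {}c : Rabs (t * t * t * (dot (Lam v) s + dot (Lam s) v + t * dot (Lam s) s))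
    <= eps * (t * t).
  rewrite Rabs_mult Rabs_pos_eq; last by have := Rle_0_sqr t; rewrite /Rsqr; nra.
  apply: (Rle_trans _ (t * t * t * C)).
    by apply: Rmult_le_compat_l => //; have := Rle_0_sqr t; rewrite /Rsqr; nra.
  have tc : t * C <= eps.
    have : eps = eps / (C + 1) * (C + 1) by field; lra.
    by nra.
  by have := Rle_0_sqr t; rewrite /Rsqr; nra.
move=> p; move: c.
set z := t * t * t * _ => c.
have {q}p := Rle_trans _ _ _ p q.
rewrite -/z in p; move: (z) c p {Hd gr} => z0 c p.
by split_Rabs; lra.
Qed.

Lemma vector_expansion {N d S K G zb r} (cs : @conic_system N d S K G zb r) v s (eps : R) :
  0 < eps -> exists del, 0 < del /\ forall t, 0 < t < del ->
    norm (vsub (G (vadd zb (vadd (vscale t v) (vscale (t * t) s))))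
      (vadd (vscale t (fderiv G zb v))
         (vscale (t * t) (vadd (fderiv G zb s) (vscale (/ 2) (hess G zb v v))))))
    <= eps * (t * t).
Proof.
move=> eps0; have n0 := pos_INR d.
have e1 : 0 < eps / (INR d + 1) by apply: Rdiv_lt_0_compat; lra.
have [||dl [dl0 H]] := @finite_pos d (fun i dl => forall t, 0 < t < dl ->
    Rabs (vsub (G (vadd zb (vadd (vscale t v) (vscale (t * t) s))))
      (vadd (vscale t (fderiv G zb v))
         (vscale (t * t) (vadd (fderiv G zb s) (vscale (/ 2) (hess G zb v v))))) i)
    <= eps / (INR d + 1) * (t * t)).
- by move=> i a a' le Ha t lt; apply: Ha; lra.
- move=> i; have [dl [dl0 H]] :=
    quadratic_expansion cs (basis i) v (norm s) _ (norm_ge0 s) e1.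
  exists dl; split=> // t lt; have := H t s lt (Rle_refl _).
  rewrite !dot_basis /vsub /vadd /vscale; congr (_ <= _); congr Rabs; field.
exists dl; split=> // t lt.
apply: (Rle_trans _ (INR d * (eps / (INR d + 1) * (t * t)))).
  apply: norm_le_coord => [|i]; first by have := Rle_0_sqr t; rewrite /Rsqr; nra.
  exact: H.
have -> : INR d * (eps / (INR d + 1) * (t * t)) =
  eps * (t * t) - eps / (INR d + 1) * (t * t) by field; lra.
by have := Rle_0_sqr t; rewrite /Rsqr; nra.
Qed.

(** Let [s], [k] come from the approximate dual solution. Along zb + t v + t^2 s / 2 the map [G]
    stays within a small multiple of t^2 of t A v + t^2 k / 2, a point of [K], and subregularity
    corrects the arc by a comparably small multiple of t^2. As <mu, A v> = 0, the values of <mu, G>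
    on the corrected arc are governed by <zs, s> / 2 + <mu, b> / 2, which is nearly nonnegative. *)
Lemma recovery_arc {N d S K G zb r} (cs : @conic_system N d S K G zb r) v mu :
  K (fderiv G zb v) -> polar K mu -> dot mu (fderiv G zb v) = 0 ->
  (forall mu', polar K mu' -> adj (fderiv G zb) mu' = adj (fderiv G zb) mu ->
     dot mu' (hess G zb v v) <= dot mu (hess G zb v v)) ->
  forall eps, 0 < eps -> exists del, 0 < del /\ forall t, 0 < t < del ->
    exists y, S y /\ norm (vsub y (vadd zb (vscale t v))) <= eps * t /\
      - dot mu (G y) <= eps * (t * t).
Proof.
move=> Kv Kmu muv opt eps eps0; have Al := cs_linear cs; have v0 := norm_ge0 v.
have [kap [rho [kap0 [rho0 sub]]]] := cs_sub cs.
set A := fderiv G zb in Kv muv opt Al *; pose b := hess G zb v v; pose zs := adj A mu.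
have z0 := norm_ge0 zs.
have P0 : 0 < 2 + norm zs * (2 * kap + 1) by nra.
(* Losses at the scale t^2: [e1] from the expansion, [e1 / 2] from half the dual inequality, and
   [norm zs * e2] from the correction, where e2 = e1 (2 kap + 1) bounds the displacement given by
   subregularity. *)
have e1p : 0 < eps / (2 + norm zs * (2 * kap + 1)) by apply: Rdiv_lt_0_compat.
set e1 := eps / _ in e1p.
have ee : e1 * (2 + norm zs * (2 * kap + 1)) = eps by rewrite /e1; field; lra.
have [s [k [Kk [ks zs_s]]]] := approximate_dual A K zs b mu Al (cs_cone _ _ _ _ _ cs)
  Kmu erefl opt e1 e1p.
pose e2 := e1 * (2 * kap + 1); have e20 : 0 <= e2 by rewrite /e2; nra.
pose M := norm s + e2; have s0 := norm_ge0 s; have M0 : 0 <= M by rewrite /M; lra.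
have [d1 [d10 H1]] := vector_expansion cs v (vscale (/ 2) s) _ e1p.
have [d2 [d20 H2]] := quadratic_expansion cs mu v M _ M0 e1p.
have d30 : 0 < eps / (M + 1) by apply: Rdiv_lt_0_compat; lra.
have d40 : 0 < rho / (norm v + M + e2 + 1) by apply: Rdiv_lt_0_compat; lra.
exists (Rmin (Rmin 1 (Rmin d1 d2)) (Rmin (eps / (M + 1)) (rho / (norm v + M + e2 + 1)))).
split; first by do ! apply: Rmin_pos => //; lra.
move=> t [t0 /Rmin_Rgt_l [/Rmin_Rgt_l [/Rgt_lt t1 /Rmin_Rgt_l [/Rgt_lt td1 /Rgt_lt td2]]]].
move=> /Rmin_Rgt_l [/Rgt_lt td3 /Rgt_lt td4].
have tt0 : 0 < t * t by nra.
have tt1 : t * t <= t by nra.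
have {}td3 : t * M <= eps.
  have : eps = eps / (M + 1) * (M + 1) by field; lra.
  by nra.
have {}td4 : t * (norm v + M + e2 + 1) < rho.
  have : rho = rho / (norm v + M + e2 + 1) * (norm v + M + e2 + 1) by field; lra.
  by nra.
pose y0 := vadd zb (vadd (vscale t v) (vscale (t * t) (vscale (/ 2) s))).
pose k' := vadd (vscale t (A v)) (vscale (t * t) (vscale (/ 2) k)).
have Kk' : K k'.
  have [[K0 KZ] KD] := cs_cone _ _ _ _ _ cs.
  have h2 : 0 <= / 2 by lra.
  exact: KD (KZ _ _ (Rlt_le _ _ t0) Kv) (KZ _ _ (Rlt_le _ _ tt0) (KZ _ _ h2 Kk)).
have near : norm (vsub (G y0) k') <= 2 * e1 * (t * t).
  have := H1 t (conj t0 td1); rewrite -/y0 -/A -/b => le.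
  have -> : vsub (G y0) k' = vadd
      (vsub (G y0) (vadd (vscale t (A v))
         (vscale (t * t) (vadd (A (vscale (/ 2) s)) (vscale (/ 2) b)))))
      (vscale (t * t * / 2) (vsub (vadd (A s) b) k)).
    by rewrite (proj2 Al) /k'; vring.
  apply: (Rle_trans _ _ _ (norm_add _ _)); rewrite norm_scale Rabs_pos_eq; last by nra.
  have : t * t * / 2 * norm (vsub (vadd (A s) b) k) <= t * t * / 2 * e1.
    by apply: Rmult_le_compat_l => //; nra.
  by have := Rmult_lt_0_compat _ _ e1p tt0; lra.
have dy0 : norm (vsub y0 zb) <= t * (norm v + M).
  have -> : vsub y0 zb = vadd (vscale t v) (vscale (t * t * / 2) s) by rewrite /y0; vring.
  apply: (Rle_trans _ _ _ (norm_add _ _)); rewrite !norm_scale !Rabs_pos_eq; try nra.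
  have : t * t * / 2 * norm s <= t * norm s by apply: Rmult_le_compat_r => //; nra.
  by rewrite /M; nra.
have knear : kap * norm (vsub (G y0) k') + e1 * (t * t) <= e2 * (t * t).
  by have := Rmult_le_compat_l _ _ _ kap0 near; rewrite /e2; lra.
have e2t : e2 * (t * t) <= e2 * t by apply: Rmult_le_compat_l.
have [|||y [Sy ly]] := sub y0 k' (e1 * (t * t)) _ Kk'.
- by nra.
- by nra.
- by nra.
(* Rewrites the corrected point in the form zb + t v + t^2 s', with [norm s' <= M], so that the
   uniform expansion applies to it. *)
pose s' := vadd (vscale (/ 2) s) (vscale (/ (t * t)) (vsub y y0)).
have ey : y = vadd zb (vadd (vscale t v) (vscale (t * t) s')).
  by apply: functional_extensionality => i; rewrite /s' /y0 /vadd /vscale /vsub; field; lra.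
have ds : norm (vscale (/ (t * t)) (vsub y y0)) <= e2.
  have ti := Rinv_0_lt_compat _ tt0.
  rewrite norm_scale Rabs_pos_eq; last lra.
  have -> : e2 = / (t * t) * (e2 * (t * t)) by field; lra.
  by apply: Rmult_le_compat_l; lra.
have ns' : norm s' <= M.
  apply: (Rle_trans _ _ _ (norm_add _ _)); rewrite norm_scale Rabs_pos_eq; last lra.
  by rewrite /M; lra.
exists y; split=> //; split.
  have -> : vsub y (vadd zb (vscale t v)) = vscale (t * t) s' by rewrite ey; vring.
  by rewrite norm_scale Rabs_pos_eq; nra.
have := H2 t s' (conj t0 td2) ns'; rewrite -ey -/A muv -/b (dot_adj A mu s' Al) -/zs => H.
have zs' : dot zs s / 2 - norm zs * e2 <= dot zs s'.
  rewrite /s' dotDr dotZr.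
  have := dot_abs_le zs (vscale (/ (t * t)) (vsub y y0)).
  have := Rmult_le_compat_l _ _ _ z0 ds.
  by split_Rabs; lra.
have fin : (- (dot zs s' + dot mu b / 2) + e1) * (t * t) <= eps * (t * t).
  apply: Rmult_le_compat_r; first lra.
  by rewrite -ee; rewrite /e2 in zs'; nra.
by move: H; split_Rabs; lra.
Qed.

(** * The penalised problem *)

Definition penalized {N} (L : Vec N -> R) (zb w p : Vec N) (t : R) (y : Vec N) : R :=
  - L y - t * dot w (vsub y zb) + / 2 * dot (vsub y p) (vsub y p).

Lemma penalized_is_grad {N} (L : Vec N -> R) (zb w p z c : Vec N) t : is_grad L z c ->
  is_grad (penalized L zb w p t) z
    (vadd (vscale (-1) (vadd c (vscale t w))) (vsub z p)).
Proof.
move=> H eps eps0; have e2 : 0 < eps / 2 by lra.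
have [dl [dl0 Hd]] := H _ e2; exists (Rmin dl eps); split; first exact: Rmin_pos.
move=> y /Rmin_Rgt_l [/Hd le /Rgt_lt lt].
have -> : penalized L zb w p t y - penalized L zb w p t z
    - dot (vadd (vscale (-1) (vadd c (vscale t w))) (vsub z p)) (vsub y z) =
    - (L y - L z - dot c (vsub y z)) + / 2 * (norm (vsub y z) * norm (vsub y z)).
  rewrite norm_sq /penalized; have -> : vsub y p = vadd (vsub y z) (vsub z p) by vring.
  have -> : vsub y zb = vadd (vsub y z) (vsub z zb) by vring.
  move: (vsub y z) (vsub z p) (vsub z zb) => a b e.
  by rewrite !(dotDl, dotDr, dotZl) (dotC b a); field.
have n0 := norm_ge0 (vsub y z).
have : norm (vsub y z) * norm (vsub y z) <= eps * norm (vsub y z) by nra.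
have : 0 <= norm (vsub y z) * norm (vsub y z) by nra.
move: (norm (vsub y z) * norm (vsub y z)) => a.
by move: le; split_Rabs; lra.
Qed.

Lemma local_min_normal {N} (S : Vec N -> Prop) (f : Vec N -> R) z c r : S z -> 0 < r ->
  (forall y, S y -> norm (vsub y z) < r -> f z <= f y) -> is_grad f z c ->
  normal_cone S z (vscale (-1) c).
Proof.
move=> Sz r0 mn H; split=> // eps /H [dl [dl0 Hd]].
exists (Rmin dl r); split; first exact: Rmin_pos.
move=> y Sy /Rmin_Rgt_l [/Hd le /Rgt_lt /(mn y Sy) lt].
by rewrite dotZl; move: le; split_Rabs; lra.
Qed.

(** On [S] near [zb] polarity gives <mu, G> <= 0, which bounds the objective from below. The closed
    ball of radius r / 2 stays inside the ball where [S] is closed, so the minimum is attained. *)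
Lemma penalized_minimizer {N d S K G zb r} (cs : @conic_system N d S K G zb r) mu w p t :
  polar K mu -> exists z, S z /\ norm (vsub z zb) <= r / 2 /\
    forall y, S y -> norm (vsub y zb) <= r / 2 ->
      penalized (fun x => dot mu (G x)) zb w p t z <= penalized (fun x => dot mu (G x)) zb w p t y.
Proof.
move=> Kmu; have r0 := cs_pos _ _ _ _ _ cs.
set f := penalized _ zb w p t.
pose S' y := S y /\ norm (vsub y zb) <= r / 2.
have Szb : S' zb.
  split; last by rewrite norm_self; lra.
  apply/(cs_iff _ _ _ _ _ cs); first by rewrite norm_self.
  by rewrite (cs_zero _ _ _ _ _ cs); case: (cs_cone _ _ _ _ _ cs) => [[]].
have [|x [_ le]|s l Ss cv|x [Sx xr] e e0|z [[Sz zr] zmin]] :=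
  exists_minimizer S' f (- (Rabs t * (norm w * (r / 2)))) (norm zb + r / 2) zb Szb.
- move=> x [Sx xr]; rewrite /f /penalized.
  have : dot mu (G x) <= 0.
    by apply: Kmu; apply/(cs_iff _ _ _ _ _ cs) => //; lra.
  have := dot_ge0 (vsub x p).
  have a0 := Rabs_pos t; have w0 := norm_ge0 w; have x0 := norm_ge0 (vsub x zb).
  have : Rabs (t * dot w (vsub x zb)) <= Rabs t * (norm w * (r / 2)).
    rewrite Rabs_mult; apply: Rmult_le_compat_l => //.
    by apply: (Rle_trans _ _ _ (dot_abs_le _ _)); apply: Rmult_le_compat_l.
  by have := Rle_abs (t * dot w (vsub x zb)); lra.
- have -> : x = vadd zb (vsub x zb) by vring.
  by have := norm_add zb (vsub x zb); lra.
- have lr : norm (vsub l zb) <= r / 2.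
    by apply: (vconv_norm_le s l zb _ cv) => k; case: (Ss k).
  split=> //; apply: (cs_feasible_closed cs s l) => //; last lra.
  by move=> k; case: (Ss k).
- have xr' : norm (vsub x zb) < r by lra.
  have := penalized_is_grad _ zb w p x _ t
    (fderiv_is_grad G x _ mu (cs_der _ _ _ _ _ cs x xr')).
  move=> /is_grad_lip [M [dl [M0 [dl0 lip]]]].
  have e1 : 0 < e / (M + 1) by apply: Rdiv_lt_0_compat; lra.
  exists (Rmin dl (e / (M + 1))); split; first exact: Rmin_pos.
  move=> y _ /Rmin_Rgt_l [/Rgt_lt /lip le /Rgt_lt lt].
  have : e = (M + 1) * (e / (M + 1)) by field; lra.
  have y0 := norm_ge0 (vsub y x).
  have : M * norm (vsub y x) <= M * (e / (M + 1)) by apply: Rmult_le_compat_l; lra.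
  by move: le; rewrite -/f; split_Rabs; lra.
- by exists z; split=> //; split=> // y Sy yr; exact: zmin.
Qed.

(** Comparison of the minimiser with the recovery point [y]. The constant [norm w + 3 / 2] collects
    1 from [- L y], [norm w] from the linear term at [y - zb - t v], and 1 / 2 from the quadratic
    term, where e^2 <= e. *)
Lemma penalized_estimate {N} (L : Vec N -> R) (zb w v u y : Vec N) t e :
  0 < t -> 0 < e <= 1 ->
  norm (vsub y (vadd zb (vscale t v))) <= e * t -> - L y <= e * (t * t) ->
  penalized L zb w (vadd zb (vscale t v)) t (vadd zb (vscale t u)) <=
    penalized L zb w (vadd zb (vscale t v)) t y ->
  - L (vadd zb (vscale t u)) + t * t * (/ 2 * dot (vsub u v) (vsub u v)) <=
    t * t * (dot w (vsub u v) + e * (norm w + 3 / 2)).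
Proof.
move=> t0 [e0 e1] ye Ly; rewrite /penalized.
have -> : vsub (vadd zb (vscale t u)) (vadd zb (vscale t v)) = vscale t (vsub u v) by vring.
have -> : vsub (vadd zb (vscale t u)) zb = vscale t u by vring.
set a := vsub y _ in ye *.
have -> : vsub y zb = vadd a (vscale t v) by rewrite /a; vring.
have w0 := norm_ge0 w; have a0 := norm_ge0 a.
have aa : dot a a <= e * (t * t).
  have et : 0 <= e * t by nra.
  have : norm a * norm a <= (e * t) * (e * t) by apply: Rmult_le_compat.
  have : e * (e * (t * t)) <= 1 * (e * (t * t)) by apply: Rmult_le_compat_r => //; nra.
  by rewrite norm_sq; lra.
have wa : - (t * dot w a) <= e * norm w * (t * t).
  have := dot_abs_le w a; have : norm w * norm a <= norm w * (e * t).
    by apply: Rmult_le_compat_l.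
  move=> h1 h2; have : - dot w a <= norm w * (e * t) by move: h2; split_Rabs; lra.
  by move=> /(Rmult_le_compat_l t _ _ (Rlt_le _ _ t0)); lra.
by rewrite dotDr !dotZr !dotZl (dotBr w); lra.
Qed.

(** A crude bound on the larger root, avoiding square roots; it keeps the rescaled minimisers
    bounded. *)
Lemma quadratic_bound (x a c : R) : 0 <= x -> 0 <= a -> 0 <= c ->
  / 2 * (x * x) <= a * x + c -> x <= 2 * a + 2 * c + 1.
Proof.
move=> x0 a0 c0 H; apply: Rnot_lt_le => lt.
have : x * (2 * c + 1) < x * (x - 2 * a) by apply: Rmult_lt_compat_l; lra.
have : 1 * (2 * c + 1) <= x * (2 * c + 1) by apply: Rmult_le_compat_r; lra.
by lra.
Qed.

(* The minimisers [z] of [penalized] over the feasible set have the required normals by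
   Fermat's rule.  Any cluster point [u'] of [(z - zb) / t] is critical, hence
   [|u' - v|^2 / 2 <= dot w (u' - v) <= - dot w v]. *)
Lemma normal_near {N d S K G zb r} (cs : @conic_system N d S K G zb r) mu v w eta :
  polar K mu -> critical_cone S zb (adj (fderiv G zb) mu) v ->
  (forall mu', polar K mu' -> adj (fderiv G zb) mu' = adj (fderiv G zb) mu ->
     dot mu' (hess G zb v v) <= dot mu (hess G zb v v)) ->
  polar (critical_cone S zb (adj (fderiv G zb) mu)) w ->
  0 < eta -> - (2 * dot w v) < eta * eta ->
  exists del, 0 < del /\ forall t, 0 < t < del -> exists z, S z /\
    norm (vsub z (vadd zb (vscale t v))) <= eta * t /\
    normal_cone S z (vsub (vadd (adj (fderiv G z) mu) (vscale t w))
                          (vsub z (vadd zb (vscale t v)))).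
Proof.
move=> Kmu [vT zsv] opt pw eta0 wv; apply: NNPP => no.
have r0 := cs_pos _ _ _ _ _ cs; have Al := cs_linear cs.
set zs := adj _ mu in zsv opt pw.
pose L x := dot mu (G x).
have [v0 w0] := (norm_ge0 v, norm_ge0 w).
have arc := recovery_arc cs v mu (tangent_linearized cs v vT) Kmu.
rewrite dot_adj // in arc; move: (arc zsv opt) => {}arc.
pose good t z := S z /\ norm (vsub z (vadd zb (vscale t v))) <= eta * t /\
    normal_cone S z (vsub (vadd (adj (fderiv G z) mu) (vscale t w))
                          (vsub z (vadd zb (vscale t v)))).
pose C := norm w + 3 / 2.
(* If the conclusion fails, there are arbitrarily small [t] admitting no good point. For each of
   them a penalised minimiser exists; it is recorded in the rescaled form u = (z - zb) / t, so that
   compactness can be applied to [u]. *)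
have seqn k : exists tu : R * Vec N, let t := tu.1 in let u := tu.2 in
   let z := vadd zb (vscale t u) in
   0 < t < / (INR k + 1) /\ ~ good t z /\ S z /\ norm (vsub z zb) <= r / 2 /\
   (forall y, S y -> norm (vsub y zb) <= r / 2 ->
      penalized L zb w (vadd zb (vscale t v)) t z <= penalized L zb w (vadd zb (vscale t v)) t y)
   /\ - L z + t * t * (/ 2 * dot (vsub u v) (vsub u v)) <=
       t * t * (dot w (vsub u v) + / (INR k + 1) * C).
  have e0 := inv_succ_pos k; set e := / (INR k + 1) in e0 *.
  have e1 : e <= 1.
    by rewrite /e -Rinv_1; apply: Rinv_le_contravar; have := pos_INR k; lra.
  have [dl [dl0 Hd]] := arc e e0.
  have d1 : 0 < r / (2 * (norm v + 1)) by apply: Rdiv_lt_0_compat; lra.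
  have [t [t0 [/Rmin_Rgt_l [/Rgt_lt te /Rmin_Rgt_l [/Rgt_lt td /Rgt_lt tr]] bad]]] :
      exists t, 0 < t /\ t < Rmin e (Rmin dl (r / (2 * (norm v + 1)))) /\
        ~ exists z, good t z.
    apply: NNPP => H; apply: no; exists (Rmin e (Rmin dl (r / (2 * (norm v + 1))))).
    split; first by do ! apply: Rmin_pos.
    by move=> t [t0 lt]; apply: NNPP => bad; apply: H; exists t.
  have [y [Sy [yt Ly]]] := Hd t (conj t0 td).
  have [z [Sz [zr zmin]]] := penalized_minimizer cs mu w (vadd zb (vscale t v)) t Kmu.
  have ez : vadd zb (vscale t (vscale (/ t) (vsub z zb))) = z.
    by apply: functional_extensionality => i; rewrite /vadd /vscale /vsub; field; lra.
  exists (t, vscale (/ t) (vsub z zb)) => /=; rewrite ez; split=> //.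
  split; first by move=> g; apply: bad; exists z.
  split=> //; split=> //; split; first exact: zmin.
  have := penalized_estimate L zb w v (vscale (/ t) (vsub z zb)) y t e t0 (conj e0 e1) yt Ly.
  rewrite ez /C; apply; apply: zmin => //.
  have -> : vsub y zb = vadd (vsub y (vadd zb (vscale t v))) (vscale t v) by vring.
  apply: (Rle_trans _ _ _ (norm_add _ _)); rewrite norm_scale Rabs_pos_eq; last lra.
  have : e * t <= 1 * t by apply: Rmult_le_compat_r; lra.
  have -> : r / 2 = r / (2 * (norm v + 1)) * (norm v + 1) by field; lra.
  have : t * (norm v + 1) <= r / (2 * (norm v + 1)) * (norm v + 1).
    by apply: Rmult_le_compat_r; lra.
  by lra.
have /(_ _)/constructive_indefinite_description f := seqn.
pose t k := (sval (f k)).1; pose u k := (sval (f k)).2.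
have {seqn} Hf k : let z := vadd zb (vscale (t k) (u k)) in
   0 < t k < / (INR k + 1) /\ ~ good (t k) z /\ S z /\ norm (vsub z zb) <= r / 2 /\
   (forall y, S y -> norm (vsub y zb) <= r / 2 ->
      penalized L zb w (vadd zb (vscale (t k) v)) (t k) z
      <= penalized L zb w (vadd zb (vscale (t k) v)) (t k) y)
   /\ - L z + t k * t k * (/ 2 * dot (vsub (u k) v) (vsub (u k) v))
      <= t k * t k * (dot w (vsub (u k) v) + / (INR k + 1) * C) := svalP (f k).
have Lle x : S x -> norm (vsub x zb) < r -> L x <= 0.
  by move=> Sx xr; apply: Kmu; apply/(cs_iff _ _ _ _ _ cs).
clearbody t u; clear f no arc opt.
have C0 : 0 < C by rewrite /C; lra.
have inv1 k : / (INR k + 1) <= 1.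
  by rewrite -Rinv_1; apply: Rinv_le_contravar; have := pos_INR k; lra.
have wu k : dot w (vsub (u k) v) <= norm w * norm (vsub (u k) v) by exact: dot_le.
(* Here [- L z >= 0] is dropped and the estimate divided by t^2. *)
have quad k : / 2 * (norm (vsub (u k) v) * norm (vsub (u k) v)) <=
    dot w (vsub (u k) v) + / (INR k + 1) * C.
  have [[t0 _] [_ [Sz [zr [_ le]]]]] := Hf k.
  have zr' : norm (vsub (vadd zb (vscale (t k) (u k))) zb) < r by lra.
  apply: (Rmult_le_reg_l (t k * t k)); first by nra.
  by rewrite norm_sq; have := Lle _ Sz zr'; lra.
pose B := 2 * norm w + 2 * C + 1.
have B0 : 0 < B by rewrite /B; lra.
have uB k : norm (vsub (u k) v) <= B.
  apply: quadratic_bound => //; [exact: norm_ge0|lra|].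
  have : / (INR k + 1) * C <= 1 * C by apply: Rmult_le_compat_r; [lra|exact: inv1].
  by have := quad k; have := wu k; lra.
have nu k : norm (u k) <= B + norm v.
  have -> : u k = vadd (vsub (u k) v) v by vring.
  by have := norm_add (vsub (u k) v) v; have := uB k; lra.
have Llow k : - L (vadd zb (vscale (t k) (u k))) <= t k * t k * (norm w * B + C).
  have [[t0 t1] [_ [_ [_ [_ le]]]]] := Hf k.
  have sq0 : 0 <= t k * t k * (/ 2 * dot (vsub (u k) v) (vsub (u k) v)).
    by have := dot_ge0 (vsub (u k) v); nra.
  have ic : / (INR k + 1) * C <= 1 * C by apply: Rmult_le_compat_r; [lra|exact: inv1].
  have wB : norm w * norm (vsub (u k) v) <= norm w * B by apply: Rmult_le_compat_l.
  have : t k * t k * (dot w (vsub (u k) v) + / (INR k + 1) * C) <=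
      t k * t k * (norm w * B + C).
    by apply: Rmult_le_compat_l; [nra|have := wu k; lra].
  by lra.
have [phi [u' [ge cv]]] := bounded_subseq u _ nu.
have ev e : 0 < e -> exists k, t k < e /\ / (INR k + 1) < e /\ norm (vsub (u k) u') < e.
  move=> e0; have [n1 H1] := inv_succ_small e e0; have [n2 H2] := cv e e0.
  exists (phi (maxn n1 n2)).
  have := H1 _ (leq_trans (leq_maxl n1 n2) (ge _)); have := H2 _ (leq_maxr n1 n2).
  by have [[_ lt] _] := Hf (phi (maxn n1 n2)); lra.
have uT : tangent_cone S zb u'.
  apply: tangent_of_approx => e /ev [k [te [_ ue]]]; exists (t k), (u k).
  by have [[t0 _] [_ [Sz _]]] := Hf k.
have muE x : dot mu (fderiv G zb x) = dot zs x by exact: dot_adj.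
have zs_le : dot zs u' <= 0.
  by rewrite -muE; apply: Kmu; exact: tangent_linearized cs u' uT.
have z0 := norm_ge0 zs.
(* The estimate also bounds - L(z) by a multiple of t^2, whereas L(z) = t <zs, u> + o(t); dividing
   by [t] excludes a negative <zs, u'>. Three errors of e / 3 arise: the remainder, the t^2 bound,
   and the replacement of [u k] by [u']. *)
have zs_ge : - dot zs u' <= 0.
  apply: le_epsilon => e e0; rewrite Rplus_0_l.
  have Bv : 0 < B + norm v + 1 by lra.
  have e1 : 0 < e / (3 * (B + norm v + 1)) by apply: Rdiv_lt_0_compat; lra.
  have [dl [dl0 Hd]] := fderiv_is_grad G zb _ mu (cs_base cs) _ e1.
  have D0 : 0 < norm w * B + C + 1 by nra.
  have [k [tk [_ uk]]] := ev (Rmin (Rmin (dl / (B + norm v + 1)) (e / (3 * (norm w * B + C + 1))))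
                         (e / (3 * (norm zs + 1)))) ltac:(
    by do ! apply: Rmin_pos; apply: Rdiv_lt_0_compat; lra).
  have [[t0 t1] _] := Hf k.
  have td : t k < dl / (B + norm v + 1).
    by apply: Rlt_le_trans tk _; apply: Rle_trans (Rmin_l _ _) (Rmin_l _ _).
  have te : t k < e / (3 * (norm w * B + C + 1)).
    by apply: Rlt_le_trans tk _; apply: Rle_trans (Rmin_l _ _) (Rmin_r _ _).
  have ue : norm (vsub (u k) u') < e / (3 * (norm zs + 1)).
    by apply: Rlt_le_trans uk _; exact: Rmin_r.
  have := Hd (vadd zb (vscale (t k) (u k))).
  have -> : vsub (vadd zb (vscale (t k) (u k))) zb = vscale (t k) (u k) by vring.
  rewrite norm_scale (Rabs_pos_eq (t k)); last lra.
  have un := norm_ge0 (u k); have nuk := nu k.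
  have lt : t k * norm (u k) < dl.
    have : dl = dl / (B + norm v + 1) * (B + norm v + 1) by field; lra.
    have : t k * norm (u k) <= t k * (B + norm v + 1) by apply: Rmult_le_compat_l; lra.
    have : t k * (B + norm v + 1) < dl / (B + norm v + 1) * (B + norm v + 1).
      by apply: Rmult_lt_compat_r.
    by lra.
  move=> /(_ lt); rewrite (cs_zero _ _ _ _ _ cs) dot0r -/zs dotZr => le.
  have p1 : e / (3 * (B + norm v + 1)) * norm (u k) <= e / 3.
    have -> : e / 3 = e / (3 * (B + norm v + 1)) * (B + norm v + 1) by field; lra.
    by apply: Rmult_le_compat_l; lra.
  have p2 : t k * (norm w * B + C) <= e / 3.
    have -> : e / 3 = e / (3 * (norm w * B + C + 1)) * (norm w * B + C + 1) by field; lra.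
    by apply: Rmult_le_compat; nra.
  have p3 : dot zs (vsub (u k) u') <= e / 3.
    have -> : e / 3 = (norm zs + 1) * (e / (3 * (norm zs + 1))) by field; lra.
    apply: (Rle_trans _ _ _ (dot_le _ _)); apply: Rmult_le_compat; try lra.
    exact: norm_ge0.
  have p4 : t k * - dot zs (u k) <= t k * (t k * (norm w * B + C) + e / 3).
    have := Rmult_le_compat_l (t k) _ _ (Rlt_le _ _ t0) p1.
    by have := Llow k; move: le; rewrite -/(L _); split_Rabs; lra.
  have := Rmult_le_reg_l _ _ _ t0 p4.
  by rewrite dotBr in p3; lra.
have wu' : dot w u' <= 0 by apply: pw; split=> //; lra.
(* The strict inequality on <w, v> leaves this margin. Half of it absorbs <w, u k - u'> and half the
   term C / (k + 1), so that some [u k], not only the limit, is within [eta] of [v]. *)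
have gap : 0 < eta * eta / 2 + dot w v by lra.
set a := _ + dot w v in gap.
have d1 : 0 < a / (2 * (norm w + 1)) by apply: Rdiv_lt_0_compat; lra.
have d2 : 0 < a / (2 * C) by apply: Rdiv_lt_0_compat; lra.
have d3 : 0 < r / (2 * (B + norm v + 1)) by apply: Rdiv_lt_0_compat; lra.
have [k [tk [ik uk]]] := ev _ (Rmin_pos _ _ d1 (Rmin_pos _ _ d2 d3)).
have [[t0 _] [bad [Sz [zr [zmin _]]]]] := Hf k; apply: bad.
have /Rmin_Rgt_l [_ /Rmin_Rgt_l [_ /Rgt_lt {}tk]] := tk.
have /Rmin_Rgt_l [_ /Rmin_Rgt_l [/Rgt_lt {}ik _]] := ik.
have /Rmin_Rgt_l [/Rgt_lt {}uk _] := uk.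
set z := vadd zb _ in Sz zr zmin *.
have close : norm (vsub (u k) v) <= eta.
  have un := norm_ge0 (vsub (u k) v).
  have p1 : dot w (vsub (u k) u') <= a / 2.
    have -> : a / 2 = (norm w + 1) * (a / (2 * (norm w + 1))) by field; lra.
    apply: (Rle_trans _ _ _ (dot_le _ _)); apply: Rmult_le_compat; try lra.
    exact: norm_ge0.
  have p2 : / (INR k + 1) * C < a / 2.
    have -> : a / 2 = a / (2 * C) * C by field; lra.
    by apply: Rmult_lt_compat_r.
  have := quad k; rewrite dotBr; rewrite dotBr in p1; rewrite /a in p1 p2 => q.
  apply: Rnot_lt_le => lt.
  by have := Rmult_le_0_lt_compat _ _ _ _ (Rlt_le _ _ eta0) (Rlt_le _ _ eta0) lt lt; lra.
have ez : vsub z zb = vscale (t k) (u k) by rewrite /z; vring.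
(* The constraint to the ball of radius r / 2 is inactive at [z], so [z] is a local minimiser over
   [S] itself and Fermat's rule applies. *)
have zint : norm (vsub z zb) < r / 2.
  rewrite ez norm_scale Rabs_pos_eq; last lra.
  have -> : r / 2 = r / (2 * (B + norm v + 1)) * (B + norm v + 1) by field; lra.
  have : t k * norm (u k) <= t k * (B + norm v + 1).
    by apply: Rmult_le_compat_l; [lra|have := nu k; lra].
  have : t k * (B + norm v + 1) < r / (2 * (B + norm v + 1)) * (B + norm v + 1).
    by apply: Rmult_lt_compat_r => //; lra.
  by lra.
split=> //; split.
  have -> : vsub z (vadd zb (vscale (t k) v)) = vscale (t k) (vsub (u k) v) by rewrite /z; vring.
  rewrite norm_scale Rabs_pos_eq; last lra.
  by rewrite Rmult_comm; apply: Rmult_le_compat_r; lra.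
have zr' : norm (vsub z zb) < r by lra.
have := penalized_is_grad L zb w (vadd zb (vscale (t k) v)) z _ (t k)
  (fderiv_is_grad G z _ mu (cs_der _ _ _ _ _ cs z zr')).
have rpos : 0 < r / 2 - norm (vsub z zb) by lra.
move=> /(local_min_normal S _ z _ _ Sz rpos) nc.
have -> : vsub (vadd (adj (fderiv G z) mu) (vscale (t k) w)) (vsub z (vadd zb (vscale (t k) v))) =
  vscale (-1) (vadd (vscale (-1) (vadd (adj (fderiv G z) mu) (vscale (t k) w)))
                    (vsub z (vadd zb (vscale (t k) v)))) by vring.
apply: nc => y Sy yz; apply: zmin => //.
by have := norm_tri z y zb; lra.
Qed.

(** * Tangents to the graph of the normal cone mapping *)

(** Derivability asks for one arc serving every tolerance, while the hypothesis gives different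
    points for each. The arc takes at time [t] a point of [Om] whose distance to [z + t w] is within
    t^2 of the infimum: it is as good as every candidate up to an error o(t). *)
Lemma derivable_tangent_approx {n} (Om : Vec n -> Prop) z w : Om z ->
  (forall eta, 0 < eta -> exists del, 0 < del /\ forall t, 0 < t < del ->
     exists x, Om x /\ norm (vsub x (vadd z (vscale t w))) <= eta * t) ->
  derivable_tangent Om z w.
Proof.
move=> Oz H; exists 1; split; first lra.
pose err t x := norm (vsub x (vadd z (vscale t w))).
have pick t : exists x, (t <= 0 -> x = z) /\ Om x /\
    (0 < t -> forall y, Om y -> err t x < err t y + t * t).
  have [t0|t0] := Rle_or_lt t 0; first by exists z; split=> //; split=> //; lra.
  have [m [lb inf]] := exists_inf Om (err t) 0 z Oz (fun x _ => norm_ge0 _).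
  have [|x [Ox lt]] := inf (t * t); first by nra.
  by exists x; split=> [|]; [lra|split=> // _ y /lb; lra].
have /(_ _)/constructive_indefinite_description f := pick.
exists (fun t => sval (f t)); split; first by apply: (proj1 (svalP (f 0))); lra.
split; first by move=> t _; case: (svalP (f t)) => _ [].
move=> eta eta0; have e2 : 0 < eta / 2 by lra.
have [d [d0 Hd]] := H _ e2; exists (Rmin d (eta / 2)); split; first exact: Rmin_pos.
move=> t [t0 /Rmin_Rgt_l [/Rgt_lt td /Rgt_lt te]] _.
have [_ [_ /(_ t0) best]] := svalP (f t); move: (sval (f t)) best => x best.
have [y [Oy ly]] := Hd t (conj t0 td).
have -> : vsub (vscale (/ t) (vsub x z)) w = vscale (/ t) (vsub x (vadd z (vscale t w))).
  by apply: functional_extensionality => i; rewrite /vadd /vscale /vsub; field; lra.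
have ti := Rinv_0_lt_compat _ t0.
rewrite norm_scale Rabs_pos_eq; last lra.
have -> : eta = / t * (eta * t) by field; lra.
apply: Rmult_lt_compat_l => //.
have := best y Oy; rewrite /err => lt.
have : t * t < eta / 2 * t by apply: Rmult_lt_compat_r.
by lra.
Qed.

Lemma derivable_tangent_cone {n} (Om : Vec n -> Prop) z w :
  derivable_tangent Om z w -> tangent_cone Om z w.
Proof.
move=> [eps [eps0 [xi [xi0 [Oxi H]]]]]; apply: tangent_of_approx => e e0.
have [d [d0 Hd]] := H e e0.
pose t := Rmin (Rmin eps e) d / 2.
have m0 : 0 < Rmin (Rmin eps e) d by do ! apply: Rmin_pos.
have le1 := Rmin_l (Rmin eps e) d; have le2 := Rmin_r (Rmin eps e) d.
have le3 := Rmin_l eps e; have le4 := Rmin_r eps e.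
have t0 : 0 < t by rewrite /t; lra.
have tlt : t < Rmin (Rmin eps e) d by rewrite /t; lra.
exists t, (vscale (/ t) (vsub (xi t) z)); split; first lra.
split; first by apply: Hd; lra.
have -> : vadd z (vscale t (vscale (/ t) (vsub (xi t) z))) = xi t.
  by apply: functional_extensionality => i; rewrite /vadd /vscale /vsub; field; lra.
by apply: Oxi; lra.
Qed.

(** Test points sharing the P-component of [z] pair only with the X*-component of the normal. This
    is the passage from normals of gph Gamma to values of Psi. *)
Lemma normal_cone_section {m n l} (g : Vec (m + n) -> Vec l) C z zs :
  normal_cone (gphGamma g C) z zs -> gphPsi g C (vpair z (vsnd zs)).
Proof.
rewrite /gphPsi vfst_pair vsnd_pair => -[Sz H].
split; first by rewrite /Gamma vpair_eta.
move=> eps /H [d [d0 Hd]]; exists d; split=> // x Cx lt.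
have e : vsub (vpair (vfst z) x) z = vpair vzero (vsub x (vsnd z)).
  rewrite -{2}(vpair_eta z) vpair_sub; congr vpair; vring.
have := Hd (vpair (vfst z) x) Cx; rewrite e norm_vpair0 => /(_ lt).
by rewrite -{1}(vpair_eta zs) dot_vpair dot0r Rplus_0_l.
Qed.

(** Tangent cones need not be convex; this one is because under MSCQ it equals the preimage of [K]
    under the derivative. Stability under doubling is recorded to test normals at both 0 and 2 v. *)
Lemma critical_cone_convex {N d S K G zb r} (cs : @conic_system N d S K G zb r) zs :
  is_convex (critical_cone S zb zs) /\ critical_cone S zb zs vzero /\
  forall v, critical_cone S zb zs v -> critical_cone S zb zs (vscale 2 v).
Proof.
have [AD AZ] := cs_linear cs; have [[K0 KZ] KD] := cs_cone _ _ _ _ _ cs.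
split; [|split].
- move=> x y t [/(tangent_linearized cs) Kx zx] [/(tangent_linearized cs) Ky zy] t01.
  split; last by rewrite dotDr !dotZr zx zy; ring.
  apply: (linearized_tangent cs); rewrite AD !AZ.
  by apply: KD; apply: KZ => //; lra.
- by split; [apply: (linearized_tangent cs); rewrite linear0|rewrite dot0r].
- move=> v [/(tangent_linearized cs) Kv zv]; split; last by rewrite dotZr zv; ring.
  by apply: (linearized_tangent cs); rewrite AZ; apply: KZ => //; lra.
Qed.

(** Contracting [y] towards [v] along the segment brings it into the range of the limsup condition,
    and both sides scale linearly. *)
Lemma convex_normal {n} (T : Vec n -> Prop) v w : is_convex T -> T v -> normal_cone T v w ->
  forall y, T y -> dot w (vsub y v) <= 0.
Proof.
move=> cv Tv [_ H] y Ty; apply: le_epsilon => e e0; rewrite Rplus_0_l.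
have n0 := norm_ge0 (vsub y v).
have e1 : 0 < e / (norm (vsub y v) + 1) by apply: Rdiv_lt_0_compat; lra.
have [d [d0 Hd]] := H _ e1.
pose t := Rmin 1 (d / (norm (vsub y v) + 1)).
have t0 : 0 < t by apply: Rmin_pos; [lra|apply: Rdiv_lt_0_compat; lra].
have t1 : t <= 1 := Rmin_l _ _.
have td : t * (norm (vsub y v) + 1) <= d.
  have -> : d = d / (norm (vsub y v) + 1) * (norm (vsub y v) + 1) by field; lra.
  by apply: Rmult_le_compat_r; [lra|exact: Rmin_r].
have ex : vsub (vadd (vscale t y) (vscale (1 - t) v)) v = vscale t (vsub y v) by vring.
have := Hd _ (cv y v t Ty Tv (conj (Rlt_le _ _ t0) t1)).
rewrite ex norm_scale Rabs_pos_eq ?dotZr; last lra.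
have lt : t * norm (vsub y v) < d by lra.
move=> /(_ lt) le.
have {}le : dot w (vsub y v) <= e / (norm (vsub y v) + 1) * norm (vsub y v).
  by apply: (Rmult_le_reg_l t) => //; lra.
have : e = e / (norm (vsub y v) + 1) * (norm (vsub y v) + 1) by field; lra.
by lra.
Qed.

Lemma critical_normal_polar {N d S K G zb r} (cs : @conic_system N d S K G zb r) zs v w :
  critical_cone S zb zs v -> normal_cone (critical_cone S zb zs) v w ->
  polar (critical_cone S zb zs) w /\ dot w v = 0.
Proof.
move=> Tv nw; have [cv [T0 T2]] := critical_cone_convex cs zs.
have H := convex_normal _ v w cv Tv nw.
have wv : dot w v = 0.
  have := H _ T0; have := H _ (T2 v Tv); rewrite !dotBr dotZr dot0r; lra.
by split=> // y /H; rewrite dotBr; lra.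
Qed.

(** The hypothesis on polar elements covers both forms of the theorem. Its bound [e * e] matches
    [normal_near], where the distance to [zb + t v] is controlled by the square root of - 2 <w,
    v>. *)
Lemma graph_approx {m n l d} (g : Vec (m + n) -> Vec l) C (K : Vec d -> Prop) G zb r mu v wx :
  @conic_system (m + n) d (gphGamma g C) K G zb r ->
  let zs := adj (fderiv G zb) mu in
  polar K mu -> critical_cone (gphGamma g C) zb zs v ->
  (forall mu', polar K mu' -> adj (fderiv G zb) mu' = zs ->
     dot mu' (hess G zb v v) <= dot mu (hess G zb v v)) ->
  (forall e, 0 < e -> exists w, polar (critical_cone (gphGamma g C) zb zs) w /\
     norm (vsub (vsnd w) wx) < e /\ - (2 * dot w v) < e * e) ->
  forall eta, 0 < eta -> exists del, 0 < del /\ forall t, 0 < t < del ->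
    exists x, gphPsi g C x /\ norm (vsub x (vadd (vpair zb (vsnd zs)) (vscale t
      (vpair v (vadd (fderiv (fun z => adj (pderiv_x G z) mu) zb v) wx))))) <= eta * t.
Proof.
move=> cs zs Kmu Tv opt Hw eta eta0; have r0 := cs_pos _ _ _ _ _ cs.
have [Lam [HL _]] := adj_field_fderiv G zb r mu r0 (cs_der _ _ _ _ _ cs) (cs_der2 _ _ _ _ _ cs).
rewrite (adj_pderiv_x_fderiv G zb r mu Lam r0 (cs_der _ _ _ _ _ cs) HL).
have [Ll HLd] := HL; have [M [M0 HM]] := linear_bound _ Ll; have v0 := norm_ge0 v.
(* In units of e t, the errors are 1 for [z], [norm v + 1] for the remainder of the gradient field,
   1 for [q] in the normal, [M] for [Lam q], and 1 for the X*-component of [w]; one unit is to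
   spare. *)
have P0 : 0 < M + norm v + 5 by lra.
have e0 : 0 < Rmin 1 (eta / (M + norm v + 5)).
  by apply: Rmin_pos; [lra|exact: Rdiv_lt_0_compat].
set e := Rmin _ _ in e0.
have e1 : e <= 1 := Rmin_l _ _.
have ee : e * (M + norm v + 5) <= eta.
  have -> : eta = eta / (M + norm v + 5) * (M + norm v + 5) by field; lra.
  by apply: Rmult_le_compat_r; [lra|exact: Rmin_r].
have [w [pw [wwx wv]]] := Hw e e0.
have [d1 [d10 H1]] := normal_near cs mu v w e Kmu Tv opt pw e0 wv.
have [d2 [d20 H2]] := HLd e e0.
have d30 : 0 < d2 / (norm v + 2) by apply: Rdiv_lt_0_compat; lra.
exists (Rmin d1 (d2 / (norm v + 2))); split; first exact: Rmin_pos.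
move=> t [t0 /Rmin_Rgt_l [/Rgt_lt td1 /Rgt_lt td2]].
have [z [Sz [zv nz]]] := H1 t (conj t0 td1).
exists (vpair z (vsnd (vsub (vadd (adj (fderiv G z) mu) (vscale t w))
                            (vsub z (vadd zb (vscale t v)))))).
split; first exact: normal_cone_section.
set q := vsub z _ in zv nz *.
have ez : vsub z zb = vadd q (vscale t v) by rewrite /q; vring.
have nq := norm_ge0 q.
have dz : norm (vsub z zb) <= t * (norm v + 1).
  rewrite ez; apply: (Rle_trans _ _ _ (norm_add _ _)); rewrite norm_scale Rabs_pos_eq; last lra.
  have : e * t <= 1 * t by apply: Rmult_le_compat_r; lra.
  by lra.
have lt : norm (vsub z zb) < d2.
  have : d2 = d2 / (norm v + 2) * (norm v + 2) by field; lra.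
  have : t * (norm v + 2) < d2 / (norm v + 2) * (norm v + 2).
    by apply: Rmult_lt_compat_r; lra.
  by lra.
have le := H2 z lt; rewrite -/zs in le.
set R1 := vsub (vsub _ _) _ in le.
rewrite vpair_scale vpair_add vpair_sub -/q.
(* Because z - zb = q + t v, linearity of [Lam] splits off the wanted [t Lam v]; what remains is the
   remainder [R1], the deviation [q] with its image [Lam q], and the error in [wx]. *)
have -> : vsub (vsnd (vsub (vadd (adj (fderiv G z) mu) (vscale t w)) q))
    (vadd (vsnd zs) (vscale t (vadd (vsnd (Lam v)) wx))) =
    vadd (vsnd (vadd (vsub R1 q) (Lam q))) (vscale t (vsub (vsnd w) wx)).
  rewrite /R1 ez (proj1 Ll) (proj2 Ll); apply: functional_extensionality => i.
  by rewrite /vsnd /vadd /vsub /vscale; ring.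
apply: (Rle_trans _ _ _ (norm_vpair_le _ _)).
have b1 := norm_add (vsnd (vadd (vsub R1 q) (Lam q))) (vscale t (vsub (vsnd w) wx)).
have b2 := norm_vsnd_le (vadd (vsub R1 q) (Lam q)).
have b3 := norm_add (vsub R1 q) (Lam q).
have b4 := norm_sub R1 q.
have b5 := HM q.
have b6 : M * norm q <= M * (e * t) by apply: Rmult_le_compat_l.
have b7 : e * norm (vsub z zb) <= e * (t * (norm v + 1)) by apply: Rmult_le_compat_l; lra.
have b8 : t * norm (vsub (vsnd w) wx) <= t * e by apply: Rmult_le_compat_l; lra.
have b9 := Rmult_le_compat_r t _ _ (Rlt_le _ _ t0) ee.
have b10 : 0 < e * t by apply: Rmult_lt_0_compat.
rewrite norm_scale Rabs_pos_eq in b1; last lra.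
by lra.
Qed.

Theorem theorem3p3
  (m n l d : nat)
  (g : Vec (m + n) -> Vec l) (C : Vec l -> Prop)
  (K : Vec d -> Prop) (V : Vec l -> Prop) (h : Vec l -> Vec d)
  (pb : Vec m) (xb : Vec n) (xsb : Vec n)
  (* setting *)
  (HC : is_closed C)
  (Hg : exists r, 0 < r /\ C2_on (ball (vpair pb xb) r) g)
  (HVo : is_open V) (HVg : V (g (vpair pb xb)))
  (Hh : C2_on V h) (Hh0 : h (g (vpair pb xb)) = vzero)
  (Hhs : surjective_map (fderiv h (g (vpair pb xb))))
  (HCV : forall y, V y -> (C y <-> K (h y)))
  (HKc : is_closed K) (HKv : is_convex K) (HKk : is_cone K)
  (Hxb : Gamma g C pb xb)
  (Hxsb : normal_cone (Gamma g C pb) xb xsb)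
  (* MSCQ *)
  (HMS : MSCQ (fun z => h (g z)) K (vpair pb xb)) :
  (forall (zs : Vec (m + n)) (q : Vec m) (u : Vec n) (muh : Vec d)
          (wx : Vec n) (ws : nat -> Vec (m + n)),
     normal_cone (gphGamma g C) (vpair pb xb) zs ->
     vsnd zs = xsb ->
     critical_cone (gphGamma g C) (vpair pb xb) zs (vpair q u) ->
     mult_set_v (fun z => h (g z)) K (vpair pb xb) zs (vpair q u) muh ->
     (forall k, polar (critical_cone (gphGamma g C) (vpair pb xb) zs) (ws k)) ->
     vconv (fun k => vsnd (ws k)) wx ->
     Un_cv (fun k => dot (ws k) (vpair q u)) 0 ->
     let tv := vpair (vpair q u)
                 (vadd (fderiv (fun z => adj (pderiv_x (fun y => h (g y)) z) muh)
                               (vpair pb xb) (vpair q u)) wx) in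
     tangent_cone (gphPsi g C) (vpair (vpair pb xb) xsb) tv /\
     derivable_tangent (gphPsi g C) (vpair (vpair pb xb) xsb) tv)
  /\
  (forall (zs : Vec (m + n)) (q : Vec m) (u : Vec n) (muh : Vec d) (ws : Vec (m + n)),
     normal_cone (gphGamma g C) (vpair pb xb) zs ->
     vsnd zs = xsb ->
     critical_cone (gphGamma g C) (vpair pb xb) zs (vpair q u) ->
     mult_set_v (fun z => h (g z)) K (vpair pb xb) zs (vpair q u) muh ->
     normal_cone (critical_cone (gphGamma g C) (vpair pb xb) zs) (vpair q u) ws ->
     tangent_cone (gphPsi g C) (vpair (vpair pb xb) xsb)
       (vpair (vpair q u)
          (vadd (fderiv (fun z => adj (pderiv_x (fun y => h (g y)) z) muh)
                        (vpair pb xb) (vpair q u)) (vsnd ws)))).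
Proof.
have [r [r0 g2]] := Hg; set zb := vpair pb xb.
set G : Vec (m + n) -> Vec d := fun z => h (g z).
have [rho [rho0 [near der2]]] := comp_twice_fderivable g h V zb r r0 g2 HVo HVg Hh.
have cs : conic_system (gphGamma g C) K G zb rho.
  split=> //; last exact: cone_additive.
    by move=> y /near [Vy _]; exact: HCV.
  by move=> y /near [].
(* Common core of both claims. The first takes late members of the sequence; the second takes the
   given normal itself at every tolerance, since it is polar to the critical cone and orthogonal to
   the direction. *)
have main zs q u muh wx : mult_set_v G K zb zs (vpair q u) muh -> vsnd zs = xsb ->
    critical_cone (gphGamma g C) zb zs (vpair q u) ->
    (forall e, 0 < e -> exists w, polar (critical_cone (gphGamma g C) zb zs) w /\
       norm (vsub (vsnd w) wx) < e /\ - (2 * dot w (vpair q u)) < e * e) ->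
    derivable_tangent (gphPsi g C) (vpair zb xsb) (vpair (vpair q u)
      (vadd (fderiv (fun z => adj (pderiv_x G z) muh) zb (vpair q u)) wx)).
  move=> [[Kmu muE] opt] zsx Tv Hw; apply: derivable_tangent_approx.
    by rewrite /gphPsi !vfst_pair !vsnd_pair.
  rewrite -zsx; move: muE opt Tv Hw {zsx} => <- opt Tv Hw.
  apply: (graph_approx g C K G zb rho muh _ _ cs) => // mu' Kmu' e.
  exact: opt.
split.
- move=> zs q u muh wx ws _ zsx Tv Hmu pws cvx cv0 tv.
  suff D : derivable_tangent (gphPsi g C) (vpair zb xsb) tv.
    by split=> //; exact: derivable_tangent_cone.
  apply: (main zs) => // e e0.
  have e2 : 0 < e * e / 2 by nra.
  have [n1 H1] := cvx e e0; have [n2 H2] := cv0 _ e2.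
  exists (ws (maxn n1 n2)); split=> //; split; first exact: H1 (leq_maxl _ _).
  have := H2 _ (elimT leP (leq_maxr n1 n2)); rewrite /R_dist Rminus_0_r.
  by split_Rabs; lra.
- move=> zs q u muh w _ zsx Tv Hmu nw.
  have [pw wv] := critical_normal_polar cs zs (vpair q u) w Tv nw.
  apply: derivable_tangent_cone; apply: (main zs) => // e e0.
  by exists w; rewrite norm_self wv; split=> //; split=> //; nra.
Qed.
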